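(* Let $d\ge 3$ and let $\frac12\gamma_d$ be the half-$d$-cube. Then: (i) $\frac12\gamma_d$ has $d!\,2^{d-1}(d-2)$ flags, forming one orbit under its symmetry group for $d=3,4$ and $d-2$ orbits for $d\ge 5$. (ii) $\frac12\gamma_d$ is $z$-uniform.
   Context: The half-cube $\frac12\gamma_d$ is the $d$-polytope which is the convex hull of the vectors in $\{0,1\}^d$ with an even number of coordinates equal to $1$. For a $d$-polytope $P$, a flag is a maximal chain $F_1\subset F_2\subset\dots\subset F_d$ of proper nonempty faces with $\dim F_i=i-1$. For $1\le i\le d$, $\sigma_i$ is the involution on flags replacing $F_i$ by the unique other face $F_i'\neq F_i$ with $F_{i-1}\subset F_i'\subset F_{i+1}$ (where $F_0=\emptyset$, $F_{d+1}=P$). Put $T=\sigma_d\sigma_{d-1}\cdots\sigma_1$ ($\sigma_1$ applied first). A zigzag is a circuit $Z=(f_1,\dots,f_l)$ of flags (an orbit of $T$, listed cyclically, up to cyclic shift) with $f_{j+1}=T(f_j)$, indices modulo $l$; $l$ is its length. For a flag $f=(F_1,\dots,F_d)$ there is a unique family of faces $(x_{i,j})_{1\le i\le d,1\le j\le d+1-i}$ with $x_{i,1}=F_i$, $\dim x_{i,j}=i-1$, $x_{i,j}\subset x_{i+1,j}$, $x_{i,j}\subset x_{i+1,j-1}$, and $x_{i,j}\ne x_{i,j-1}$ whenever the indices make sense; the reverse of $f$ is the flag $f^t=(x_{1,d},x_{2,d-1},\dots,x_{d,1})$. The reverse of $Z=(f_1,\dots,f_l)$ is the zigzag $Z^t=(f_l^t,\dots,f_1^t)$;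 a zigzag is identified with its reverse. The signature of $Z$ is the pair $(n_I,n_{II})$, where $2n_I$ is the number of $j$ with $\sigma_1(f_j)\in Z$ and $2n_{II}$ is the number of $j$ with $\sigma_1(f_j)\in Z^t$. $P$ is $z$-uniform if all its zigzags have the same length and the same signature. The symmetry group is the group of isometries preserving the polytope. *)

(* Defs.v *)
From HB Require Import structures.
From mathcomp Require Import all_boot all_order all_algebra.
From mathcomp Require Import all_classical all_reals.

Set Implicit Arguments.
Unset Strict Implicit.
Unset Printing Implicit Defensive.

Import Order.TTheory GRing.Theory Num.Theory.
Local Open Scope classical_set_scope.
Local Open Scope ring_scope.

Section Polytopes.
Context {R : realType} {d : nat}.
Implicit Types (x y c : 'rV[R]_d) (P F : set 'rV[R]_d).

Definition dot x y : R := \sum_i x 0 i * y 0 i.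

(* The norm that MathComp-Analysis puts on 'rV[R]_d is the sup norm, hence an
   explicit Euclidean distance. *)
Definition edist x y : R := Num.sqrt (dot (x - y) (x - y)).

Definition convex_hull (V : set 'rV[R]_d) : set 'rV[R]_d :=
  [set x : 'rV[R]_d | exists n (p : 'I_n -> 'rV[R]_d) (w : 'I_n -> R),
    [/\ forall k, V (p k), forall k, 0 <= w k, \sum_k w k = 1 &
        x = \sum_k w k *: p k]].

(* c = 0 is allowed, so that set0 and P itself are faces. *)
Definition is_face P F : Prop :=
  exists c (b : R), (forall x, P x -> dot c x <= b) /\
                    F = P `&` [set x | dot c x = b].

Definition proper_nonempty_face P F : Prop :=
  [/\ is_face P F, F !=set0 & F <> P].

Definition affinely_independent n (p : 'I_n.+1 -> 'rV[R]_d) : bool :=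
  row_free (\matrix_(i < n) (p (lift ord0 i) - p ord0)).

Definition has_dim F (n : nat) : Prop :=
  (exists p : 'I_n.+1 -> 'rV[R]_d,
      affinely_independent p /\ forall k, F (p k)) /\
  (forall m (p : 'I_m.+1 -> 'rV[R]_d),
      affinely_independent p -> (forall k, F (p k)) -> (m <= n)%N).

Definition symmetry P (phi : 'rV[R]_d -> 'rV[R]_d) : Prop :=
  (forall x y, edist (phi x) (phi y) = edist x y) /\ phi @` P = P.

End Polytopes.

Definition half_cube_vertices (R : realType) (d : nat) : set 'rV[R]_d :=
  [set v : 'rV[R]_d | (forall i, v 0 i = 0 \/ v 0 i = 1) /\
           ~~ odd #|[set i | v 0 i == 1]%SET|].

Arguments half_cube_vertices R d : clear implicits.

Definition half_cube (R : realType) (d : nat) : set 'rV[R]_d :=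
  convex_hull (half_cube_vertices R d).

Arguments half_cube R d : clear implicits.

(* The flag (F_1, ..., F_d) is the function k |-> F_(k + 1) on 'I_d. *)
Definition preflag (R : realType) (d : nat) := 'I_d -> set 'rV[R]_d.

Section Flags.
Context {R : realType} {d : nat}.
Variable P : set 'rV[R]_d.
Implicit Types (f g : preflag R d) (Z : seq (preflag R d)).

(* F_i for 0 <= i <= d + 1, where F_0 = set0 and F_(d+1) = P. *)
Definition level f (i : nat) : set 'rV[R]_d :=
  if i is k.+1 then (if insub k is Some o then f o else P) else set0.

Definition is_flag f : Prop :=
  (forall k : 'I_d, proper_nonempty_face P (f k) /\ has_dim (f k) k) /\
  (forall k l : 'I_d, (k < l)%N -> f k `<` f l).

Definition flags : set (preflag R d) := [set f | is_flag f].

Definition flag_orbit f : set (preflag R d) :=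
  [set g | exists2 phi, symmetry P phi & g = (fun k => phi @` f k)].

Definition flag_orbits : set (set (preflag R d)) := flag_orbit @` flags.

(* The faces F' of P different from F_i with F_(i-1) < F' < F_(i+1); for a
   flag of a polytope there is exactly one of them. *)
Definition other_face f (i : nat) : set (set 'rV[R]_d) :=
  [set F' | [/\ is_face P F', F' <> level f i,
                level f i.-1 `<` F' & F' `<` level f i.+1]].

(* sigma_i, for 1 <= i <= d; xget returns the default value level f i when
   other_face f i is empty, which does not happen for flags. *)
Definition sigma (i : nat) f : preflag R d :=
  fun k => if k.+1 == i then xget (level f i) (other_face f i) else f k.

(* T = sigma_d ... sigma_1 with sigma_1 applied first. *)
Definition zstep f : preflag R d :=
  foldl (fun g i => sigma i g) f (iota 1 d).

(* A circuit is listed from any one of its flags. *)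
Definition zigzag Z : Prop :=
  [/\ Z != [::], (forall f, f \in Z -> is_flag f), uniq Z & fcycle zstep Z].

Definition array_index (i j : nat) : bool := [&& 0 < i, 0 < j & i + j <= d.+1]%N.

(* x i j, for array_index i j, is the family of faces attached to f. *)
Definition face_array f (x : nat -> nat -> set 'rV[R]_d) : Prop :=
  [/\ forall i j, array_index i j -> is_face P (x i j) /\ has_dim (x i j) i.-1,
      forall k : 'I_d, x k.+1 1%N = f k,
      forall i j, array_index i j -> array_index i.+1 j ->
        x i j `<` x i.+1 j,
      forall i j, array_index i j -> array_index i.+1 j.-1 ->
        x i j `<` x i.+1 j.-1 &
      forall i j, array_index i j -> array_index i j.-1 -> x i j <> x i j.-1].

(* f^t = (x_(1,d), x_(2,d-1), ..., x_(d,1)). *)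
Definition flag_reverse f : preflag R d :=
  xget f [set g | exists2 x, face_array f x &
                   forall k : 'I_d, g k = x k.+1 (d - k)%N].

Definition zigzag_reverse Z : seq (preflag R d) := rev (map flag_reverse Z).

(* The numbers counted are 2 n_I and 2 n_II; the pair (n_I, n_II) is taken in
   rat so that the halving loses no information. *)
Definition signature Z : rat * rat :=
  ((count (fun f => sigma 1 f \in Z) Z)%:R / 2%:R,
   (count (fun f => sigma 1 f \in zigzag_reverse Z) Z)%:R / 2%:R).

Definition z_uniform : Prop :=
  forall Z Z', zigzag Z -> zigzag Z' ->
    size Z = size Z' /\ signature Z = signature Z'.

End Flags.

(* Main.v *)
(* Vertices of the half-cube are the even subsets of 'I_d. Reading a vertex A
   relative to an odd set u, i.e. as the symmetric difference of A and u, a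
   linear form takes on A its value at u minus a sum of weights over A + u.
   Hence every face is either a simplex {u + i : i in M} or a half-cube
   {A even : A + u <= Z} with 3 <= #|Z|, and a flag is a complete flag
   N_1 < ... < N_d of subsets of 'I_d together with an odd u and a number
   3 <= k <= d: its faces are the simplices over N_1, ..., N_k followed by the
   half-cubes over N_k, ..., N_(d-1). This gives the count. Permutations of
   coordinates and even sets of reflections act transitively on the flags with
   given k. The number k only changes from k to k + 1 under sigma_(k+1) and from
   k > 3 to k - 1 under sigma_k, so T sends k to k - 1 when k > 3 and 3 to d:
   every zigzag contains a flag with k = d, and any two zigzags are related by a
   symmetry. For d >= 5, symmetries preserve k: half-cubes over at least four
   directions contain two vertices at squared distance 4 and simplices do not,
   which separates k from l > max(k, 4), while k = 3 and k = 4 are separated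
   after applying sigma_5. *)
Require Import Defs.
From mathcomp Require Import all_boot all_order all_algebra.
From mathcomp Require Import fingroup perm.
From mathcomp Require Import all_classical all_reals.
From mathcomp Require Import zify ring lra.

Set Implicit Arguments.
Unset Strict Implicit.
Unset Printing Implicit Defensive.

Import Order.TTheory GRing.Theory Num.Theory.
Local Open Scope classical_set_scope.

(** The code of a face is not unique: the base of a half-cube may be changed within its directions,
    and an edge has two bases. Faces are therefore compared through their vertex sets, and codes
    serve to compute ranks and inclusions. [sigma] and [flag_reverse] are choices by [xget], so they
    commute with symmetries only once the chosen object is known to be unique. Both uniqueness
    statements rest on [diamond]: of three faces of the middle rank between two faces whose ranks
    differ by two, two coincide. If there is nothing to choose, the default value moves along with
    the symmetry. How [sigma] changes the odd set and the chain of directions is left undetermined: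
    transitivity on flags with equal [k] absorbs both, so only [k] is followed, and it is read off
    from which faces are simplices. For [d] = 4 the values 3 and 4 of [k] are merged by a symmetry
    of the half-cube that is not a symmetry of the cube. *)

Definition symd (T : finType) (A B : {set T}) : {set T} :=
  ((A :\: B) :|: (B :\: A))%SET.

Local Notation "A :+: B" := (symd A B) (at level 52, left associativity).

(** * Symmetric differences of finite sets *)

Section SymmetricDifference.
Context {T : finType}.
Implicit Types (A B C M N X Y Z : {set T}).
Import boot.fintype boot.finset.

Lemma in_symd x A B : (x \in A :+: B) = (x \in A) (+) (x \in B).
Proof. by rewrite !inE; case: (x \in A); case: (x \in B). Qed.

Lemma symdC A B : A :+: B = B :+: A.
Proof. by apply/setP => x; rewrite !in_symd addbC. Qed.

Lemma symdA A B C : A :+: (B :+: C) = A :+: B :+: C.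
Proof. by apply/setP => x; rewrite !in_symd addbA. Qed.

Lemma symdK A B : A :+: B :+: B = A.
Proof. by apply/setP => x; rewrite !in_symd addbK. Qed.

Lemma symdKl A B : A :+: (A :+: B) = B.
Proof. by apply/setP => x; rewrite !in_symd addKb. Qed.

Lemma symd0 A : A :+: set0 = A.
Proof. by apply/setP => x; rewrite in_symd in_set0 addbF. Qed.

Lemma symdv A : A :+: A = set0.
Proof. by apply/setP => x; rewrite in_symd in_set0 addbb. Qed.

Lemma symd_eq0 A B : (A :+: B == set0) = (A == B).
Proof.
apply/eqP/eqP => [AB0|->]; last exact: symdv.
by rewrite -[LHS](symdK _ B) AB0 symdC symd0.
Qed.

Lemma symd_inj A : injective (symd A).
Proof. by move=> B C eqBC; rewrite -[LHS](symdKl A) eqBC symdKl. Qed.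

Lemma odd_symd A B : odd #|A :+: B| = odd #|A| (+) odd #|B|.
Proof.
have -> : #|A :+: B| = #|A :\: B| + #|B :\: A|.
  rewrite cardsU [_ :&: _](_ : _ = set0) ?cards0 ?subn0 //.
  by apply/setP => x; rewrite !inE; case: (x \in A); case: (x \in B).
by rewrite oddD -(cardsID B A) -(cardsID A B) !oddD [B :&: A]setIC;
  case: (odd _); case: (odd _); case: (odd _).
Qed.

Lemma imset_symd (s : T -> T) A B : injective s ->
  s @: (A :+: B) = s @: A :+: s @: B.
Proof.
move=> s_inj; apply/setP => y; rewrite in_symd.
apply/imsetP/idP => [[x + ->]|]; first by rewrite in_symd !mem_imset.
have [/imsetP[x xA ->]|yA] := boolP (y \in s @: A).
  by rewrite mem_imset // => xB; exists x => //; rewrite in_symd xA.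
case/imsetP => x xB yE; exists x => //; rewrite in_symd xB addbT.
by move: yA; rewrite yE mem_imset.
Qed.

(** Each of [X], [Y], [Z] adds to [M] one of the two elements of [N :\: M]. This is the diamond
    property of the subset lattice, to which diamonds of faces of one kind reduce. *)
Lemma setU1_pigeonhole M N X Y Z :
  M \subset X -> M \subset Y -> M \subset Z ->
  X \subset N -> Y \subset N -> Z \subset N ->
  #|N| = #|M|.+2 -> #|X| = #|M|.+1 -> #|Y| = #|M|.+1 -> #|Z| = #|M|.+1 ->
  [\/ X = Y, X = Z | Y = Z].
Proof.
move=> MX MY MZ XN YN ZN cN cX cY cZ.
have cD2 : #|N :\: M| = 2.
  by rewrite cardsD (setIidPr (subset_trans MX XN)); lia.
have add1 (W : {set T}) : M \subset W -> W \subset N -> #|W| = #|M|.+1 ->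
    exists2 w, W = w |: M & w \in N :\: M.
  move=> MW WN cW.
  have /eqP/cards1P[w wE] : #|W :\: M| = 1.
    by rewrite cardsD (setIidPr MW); lia.
  exists w.
    by rewrite -wE setUC setDE setUIr setUCr setIT (setUidPr MW).
  by apply: (subsetP (setSD M WN)); rewrite wE set11.
have [x -> xN] := add1 _ MX XN cX.
have [y -> yN] := add1 _ MY YN cY.
have [z -> zN] := add1 _ MZ ZN cZ.
have /eqP/cards2P[a [b [ab abE]]] := cD2.
move: xN yN zN; rewrite abE !inE.
by do 3![case/pred2P => ->]; do ?[exact: Or31 | exact: Or32 | exact: Or33].
Qed.

End SymmetricDifference.

(** * Vertex sets of faces: inclusions, ranks and the diamond property *)

Section FaceCodes.
Context {T : finType}.
Import boot.fintype boot.finset.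
Implicit Types (A B u v M N Z : {set T}) (c : bool * {set T} * {set T}).

Definition simplexv u M : {set {set T}} := [set u :+: [set i]%SET | i in M]%SET.

Definition halfv u Z : {set {set T}} :=
  [set A : {set T} | ~~ odd #|A| & A :+: u \subset Z]%SET.

Lemma symd1_inj u : injective (fun i : T => u :+: [set i]%SET).
Proof. by move=> i j /symd_inj/set1_inj. Qed.

Lemma mem_simplexv1 u M i : (u :+: [set i]%SET \in simplexv u M) = (i \in M).
Proof. exact: mem_imset (@symd1_inj u). Qed.

Lemma card_simplexv u M : #|simplexv u M| = #|M|.
Proof. exact: card_imset (@symd1_inj u). Qed.

Lemma simplexv_inj u : injective (simplexv u).
Proof.
by move=> M N MN; apply/setP => i; rewrite -!(mem_simplexv1 u) MN.
Qed.

Lemma even_simplexv u M A : odd #|u| -> A \in simplexv u M -> ~~ odd #|A|.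
Proof. by move=> uo /imsetP[i _ ->]; rewrite odd_symd uo cards1. Qed.

Lemma even_halfv u M A : A \in halfv u M -> ~~ odd #|A|.
Proof. by rewrite inE => /andP[]. Qed.

Lemma mem_halfv1 u Z i : odd #|u| ->
  (u :+: [set i]%SET \in halfv u Z) = (i \in Z).
Proof.
by move=> uo; rewrite inE odd_symd uo cards1 symdC symdKl sub1set.
Qed.

Lemma simplexv_half u Z : odd #|u| -> simplexv u Z \subset halfv u Z.
Proof.
by move=> uo; apply/subsetP => _ /imsetP[i iZ ->]; rewrite mem_halfv1.
Qed.

Lemma simplexvS u M N : (simplexv u M \subset simplexv u N) = (M \subset N).
Proof.
apply/idP/idP => [sMN|]; last exact: imsetS.
by apply/subsetP => i iM; rewrite -(mem_simplexv1 u) (subsetP sMN) ?mem_simplexv1.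
Qed.

Lemma halfvS u M N : odd #|u| ->
  (halfv u M \subset halfv u N) = (M \subset N).
Proof.
move=> uo; apply/idP/idP => [sMN|MN]; apply/subsetP.
  by move=> i iM; rewrite -(mem_halfv1 _ _ uo) (subsetP sMN) ?mem_halfv1.
by move=> A; rewrite !inE => /andP[-> /subset_trans->].
Qed.

Lemma halfv_inj u : odd #|u| -> injective (halfv u).
Proof.
by move=> uo M N MN; apply/setP => i; rewrite -!(mem_halfv1 _ _ uo) MN.
Qed.

(** [A :+: u] and [A :+: v] differ only by [u :+: v], which already lies in [Z]. *)
Lemma halfv_base u v Z : u :+: v \subset Z -> halfv v Z = halfv u Z.
Proof.
move=> uvZ; apply/setP => A; rewrite !inE; congr (_ && _).
apply/subsetP/subsetP => AZ x; have /implyP := subsetP uvZ x; have := AZ x;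
  by rewrite !in_symd; case: (x \in A); case: (x \in u); case: (x \in v);
    case: (x \in Z) => //= /(_ isT).
Qed.

Lemma sub_simplexv u M (X : {set {set T}}) : X \subset simplexv u M ->
  exists2 N : {set T}, N \subset M & X = simplexv u N.
Proof.
move=> sX; exists [set i in M | u :+: [set i]%SET \in X]%SET.
  by apply/subsetP => i; rewrite inE => /andP[].
apply/setP => A; apply/idP/imsetP => [AX|[i + ->]]; last first.
  by rewrite inE => /andP[].
have /imsetP[i iM AE] := subsetP sX _ AX.
by exists i => //; rewrite inE iM -AE.
Qed.

(** A vertex [u :+: [set i]] equal to some [v :+: [set j]] forces [u :+: v] to consist of [i] and
    [j]. So different bases allow at most two directions, and from three directions on the base is
    determined. *)
Lemma simplexv_sub_simplexv u v M N : simplexv u M \subset simplexv v N ->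
  u = v \/ (M \subset u :+: v) /\ (0 < #|M| -> #|u :+: v| <= 2).
Proof.
move=> sub; have [|uv] := eqVneq u v; [by left | right].
have uvE i : i \in M -> exists j, u :+: v = [set i]%SET :+: [set j]%SET.
  rewrite -(mem_simplexv1 u) => /(subsetP sub)/imsetP[j _ eq_ij]; exists j.
  apply/setP => x; move/setP/(_ x): eq_ij; rewrite !in_symd.
  by case: (x \in u); case: (x \in v); case: (x \in [set i]%SET);
    case: (x \in [set j]%SET).
split; last first.
  case/card_gt0P => i /uvE[j ->]; apply: leq_trans (_ : #|[set i; j]%SET| <= _).
    apply/subset_leq_card/subsetP => x; rewrite in_symd !inE.
    by case: (x == i); case: (x == j).
  by rewrite cards2; case: eqP.
apply/subsetP => i iM; have [j uvE'] := uvE i iM.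
rewrite uvE' in_symd !inE eqxx addTb; apply: contra_neqN uv => /eqP ij.
by apply/eqP; rewrite -symd_eq0 uvE' ij symdv.
Qed.

Lemma simplexv_sub_base u v M N : 2 < #|M| ->
  simplexv u M \subset simplexv v N -> u = v.
Proof.
move=> M3 /simplexv_sub_simplexv[//|[Muv /(_ (ltnW (ltnW M3)))]].
by move/(leq_trans (subset_leq_card Muv)); lia.
Qed.

(** Every element of [u :+: v] other than [i] lies in [u :+: [set i] :+: v], hence in [Z]; a second
    direction [j] takes care of [i] itself. So [u] is also a base of the half-cube. *)
Lemma simplexv_sub_halfv u v M Z : 1 < #|M| ->
  simplexv u M \subset halfv v Z -> M \subset Z /\ halfv v Z = halfv u Z.
Proof.
move=> /card_gt1P[i [j [iM jM ij]]] /subsetP sub.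
have MZ k x : k \in M -> x \in u :+: [set k]%SET :+: v -> x \in Z.
  by rewrite -(mem_simplexv1 u) => /sub; rewrite inE => /andP[_ /subsetP]; apply.
have uvZ : u :+: v \subset Z.
  apply/subsetP => x; rewrite in_symd => xuv.
  have [xi|xi] := eqVneq x i.
    by apply: (MZ j) => //; rewrite !in_symd inE xi (negPf ij) addbF -xi.
  by apply: (MZ i) => //; rewrite !in_symd inE (negPf xi) addbF.
split; last exact: halfv_base.
apply/subsetP => k kM; have [|kuv] := boolP (k \in u :+: v).
  by move/(subsetP uvZ).
apply: (MZ k) => //; rewrite !in_symd inE eqxx addbAC.
by move: kuv; rewrite in_symd => /negPf->.
Qed.

(** The simplex over [M] inside the half-cube forces [u = v], and three directions [a], [b], [c] of
    [M] give the vertex [u :+: [set a; b; c]], which no single direction reaches from [u]. *)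
Lemma halfv_nsub_simplexv u v M N : odd #|u| -> 2 < #|M| ->
  halfv u M \subset simplexv v N = false.
Proof.
move=> uo M3; apply/negP => sub.
have uv := simplexv_sub_base M3 (subset_trans (simplexv_half M uo) sub).
have /card_gt2P[a [b [c [[aM bM cM] [ab bc ca]]]]] := M3.
have abc3 : #|[set a; b; c]%SET| = 3.
  by rewrite setUC cardsU1 cards2 !inE negb_or ca [c == b]eq_sym bc ab.
have /(subsetP sub)/imsetP[i _] : u :+: [set a; b; c]%SET \in halfv u M.
  rewrite inE odd_symd uo abc3 symdC symdKl /=.
  by apply/subsetP => x; rewrite !inE => /orP[/pred2P[]->|/eqP->].
by rewrite uv => /symd_inj abcE; move: abc3; rewrite abcE cards1.
Qed.

Lemma halfv_sub_halfv u v M N : odd #|u| -> 2 < #|M| ->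
  halfv u M \subset halfv v N -> M \subset N /\ halfv v N = halfv u N.
Proof.
move=> uo M3 sub; apply: simplexv_sub_halfv (ltnW M3) _.
exact: subset_trans (simplexv_half M uo) sub.
Qed.

(* (h, u, M) codes the half-cube (h = true) or the simplex (h = false) in the
   directions M based at the odd set u. *)
Definition fverts c : {set {set T}} :=
  if c.1.1 then halfv c.1.2 c.2 else simplexv c.1.2 c.2.

(** A half-cube over at most two directions with odd base is the simplex over the same directions;
    asking for three directions keeps the two kinds disjoint. *)
Definition valid c : bool := odd #|c.1.2| && (c.1.1 ==> (2 < #|c.2|)).

(** The dimension plus one: the simplex has [#|M|] affinely independent vertices, the half-cube has
    dimension [#|M|]. *)
Definition frank c : nat := #|c.2| + c.1.1.

Lemma even_fverts c A : valid c -> A \in fverts c -> ~~ odd #|A|.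
Proof.
case: c => [[[] u] M] /= /andP[uo _]; first exact: even_halfv.
exact: even_simplexv.
Qed.

Lemma frank_sub c1 c2 : valid c1 -> valid c2 ->
  fverts c1 \subset fverts c2 ->
  frank c1 <= frank c2 /\ (frank c1 = frank c2 -> fverts c1 = fverts c2).
Proof.
case: c1 => [[[] u] M]; case: c2 => [[[] v] N];
  rewrite /valid /frank /fverts /= !(addn0, addn1) => /andP[uo M3] /andP[vo N3] sub.
- have [MN ->] := halfv_sub_halfv uo M3 sub.
  split=> [|[]/eqP MN']; first by rewrite ltnS subset_leq_card.
  by congr halfv; apply/eqP; rewrite eqEcard MN (eqP MN') /=.
- by rewrite halfv_nsub_simplexv in sub.
- have [M2|M2] := leqP #|M| 1; first by split; lia.
  have [/subset_leq_card MN _] := simplexv_sub_halfv M2 sub.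
  by split; lia.
- rewrite -(card_simplexv u M) -(card_simplexv v N); split => [|MN].
    exact: subset_leq_card.
  by apply/eqP; rewrite eqEcard sub MN /=.
Qed.

Lemma frank_proper c1 c2 : valid c1 -> valid c2 ->
  fverts c1 \proper fverts c2 -> frank c1 < frank c2.
Proof.
move=> v1 v2; rewrite properEneq => /andP[neq sub].
have [le_c eq_c] := frank_sub v1 v2 sub.
by rewrite ltn_neqAle le_c andbT; apply: contra_neqN neq => /eqP.
Qed.

Lemma frank_eq c1 c2 : valid c1 -> valid c2 ->
  fverts c1 = fverts c2 -> frank c1 = frank c2.
Proof.
move=> v1 v2 eq_c; apply/eqP; rewrite eqn_leq.
by rewrite (frank_sub v1 v2 _).1 ?(frank_sub v2 v1 _).1 ?eq_c.
Qed.

(** If [b] is a simplex or [a] a half-cube, all five vertex sets can be written with one base and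
    one kind, and the claim is the one on subsets. In the mixed case two candidates for the middle
    faces are listed, the half-cube over [M] and the simplex over [N], unless [a] is an edge. *)
Lemma diamond a b x y z :
  valid a -> valid b -> valid x -> valid y -> valid z ->
  frank b = (frank a).+2 ->
  [/\ frank x = (frank a).+1, frank y = (frank a).+1 & frank z = (frank a).+1] ->
  [/\ fverts a \subset fverts x, fverts a \subset fverts y
    & fverts a \subset fverts z] ->
  [/\ fverts x \subset fverts b, fverts y \subset fverts b
    & fverts z \subset fverts b] ->
  [\/ fverts x = fverts y, fverts x = fverts z | fverts y = fverts z].
Proof.
move=> va vb vx vy vz rb [rx ry rz] [ax ay az] [xb yb zb].
have pigeonhole : forall P Q : {set {set T}},
    (forall w, valid w -> frank w = (frank a).+1 ->
       fverts a \subset fverts w -> fverts w \subset fverts b ->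
       fverts w = P \/ fverts w = Q) ->
    [\/ fverts x = fverts y, fverts x = fverts z | fverts y = fverts z].
  move=> P Q PQ.
  by case: (PQ x) => // ->; case: (PQ y) => // ->; case: (PQ z) => // ->;
     do ?[exact: Or31 | exact: Or32 | exact: Or33].
case: b vb rb xb yb zb pigeonhole => [[[] v] N] vb rb xb yb zb pigeonhole;
  last first.
  have below w : valid w -> fverts w \subset simplexv v N ->
      exists2 M : {set T}, M \subset N & fverts w = simplexv v M /\ frank w = #|M|.
    move=> vw wb; have [M MN wE] := sub_simplexv wb; exists M => //; split=> //.
    have /andP[vo _] := vb.
    have vM : valid (false, v, M) by rewrite /valid /= vo.
    by rewrite (frank_eq vw vM) // /frank addn0.
  have [Mx sx [xE rx']] := below x vx xb.
  have [My sy [yE ry']] := below y vy yb.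
  have [Mz sz [zE rz']] := below z vz zb.
  have [|Ma sa [aE ra]] := below a va; first exact: subset_trans ax xb.
  move: ax ay az; rewrite xE yE zE aE !simplexvS => ax ay az.
  have := setU1_pigeonhole ax ay az sx sy sz.
  by case; rewrite ?simplexvS -?ra -?rx' -?ry' -?rz' -?rb /frank ?addn0 //;
    move=> ->; do ?[exact: Or31 | exact: Or32 | exact: Or33].
have /andP[/= vo N3] := vb.
case: a va rb rx ry rz ax ay az pigeonhole => [[[] u] M] va rb rx ry rz ax ay az pigeonhole.
  have /andP[/= uo M3] := va.
  have above w : valid w -> halfv u M \subset fverts w ->
      exists2 N : {set T}, M \subset N & fverts w = halfv u N /\ frank w = #|N|.+1.
    case: w => [[[] w] K] /andP[/= wo K3] aw; last first.
      by move: aw; rewrite /fverts /= halfv_nsub_simplexv.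
    have [MK KE] := halfv_sub_halfv uo M3 aw.
    by exists K => //; rewrite /frank /= addn1.
  have [Mx sx [xE rx']] := above x vx ax.
  have [My sy [yE ry']] := above y vy ay.
  have [Mz sz [zE rz']] := above z vz az.
  have [|Mb sb [bE rb']] := above _ vb; first exact: subset_trans ax xb.
  move: rb rx ry rz; rewrite rx' ry' rz' rb' /frank /= addn1 => - [rb] [rx] [ry] [rz].
  move: xb yb zb; rewrite xE yE zE bE !halfvS // => xb yb zb.
  by have := setU1_pigeonhole sx sy sz xb yb zb rb rx ry rz; case=> ->;
    do ?[exact: Or31 | exact: Or32 | exact: Or33].
have /andP[/= uo _] := va.
move: rb rx ry rz; rewrite /frank /= addn0 addn1 => -[rN] rx ry rz.
have M2 : 1 < #|M| by rewrite -ltnS -rN.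
have [MN NE] := simplexv_sub_halfv M2 (subset_trans ax xb).
have [M3|M3] := leqP 3 #|M|.
  apply: (pigeonhole (halfv u M) (simplexv u N)).
  case=> -[[] w] K /andP[/= wo K3]; rewrite /frank /fverts /= ?addn0 ?addn1.
    move=> [cK] aw _; have [MK ->] := simplexv_sub_halfv M2 aw; left.
    by congr halfv; apply/eqP; rewrite eq_sym eqEcard MK cK /=.
  move=> cK aw wb; right; rewrite -(simplexv_sub_base M3 aw).
  have [|/= KN _] := simplexv_sub_halfv _ wb; first by rewrite cK ltnS ltnW.
  by congr simplexv; apply/eqP; rewrite eqEcard KN cK rN /=.
(* Here [#|M|] = 2 and [b] is a tetrahedron. The edge [a] has the second base [u :+: M], and each of
   its two bases gives one triangle over [N]. *)
apply: (pigeonhole (simplexv u N) (simplexv (u :+: M) N)).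
case=> -[[] w] K /andP[/= wo K3]; rewrite /frank /fverts /= ?addn0 ?addn1.
  by move=> [cK]; move: M3; rewrite -cK ltnNge K3.
move=> cK aw wb.
have [|/= KN _] := simplexv_sub_halfv _ wb; first by rewrite cK ltnS ltnW.
have -> : K = N by apply/eqP; rewrite eqEcard KN cK rN /=.
have [->|[Muw /(_ (ltnW M2)) uw2]] := simplexv_sub_simplexv aw; first by left.
right; congr simplexv; suff -> : M = u :+: w by rewrite symdKl.
by apply/eqP; rewrite eqEcard Muw (leq_trans uw2).
Qed.

(** A supporting form may produce an even [u] and a small [Z]. Rebased at its vertex [A], the set is
    a half-cube if [Z] has at least three elements, the edge from [A] to [A :+: Z] if it has two,
    and the point [A] otherwise. *)
Lemma fverts_halfv u Z A (x0 : T) : A \in halfv u Z ->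
  exists2 c, valid c & halfv u Z = fverts c.
Proof.
rewrite inE => /andP[A_even AuZ].
rewrite (@halfv_base A u Z) //.
have oddA1 (x : T) : odd #|A :+: [set x]%SET| by rewrite odd_symd cards1 addbT.
have [Z3|Z2] := ltnP 2 #|Z|.
  have /card_gt0P[z zZ] : 0 < #|Z| by case: #|Z| Z3.
  exists (true, A :+: [set z]%SET, Z); first by rewrite /valid oddA1.
  by apply/esym/halfv_base; rewrite symdKl sub1set.
have small B : B \in halfv A Z -> B != A -> B = A :+: Z /\ #|Z| = 2.
  rewrite inE => /andP[B_even BAZ] BA.
  have BA2 : 1 < #|B :+: A|.
    have : 0 < #|B :+: A| by rewrite lt0n cards_eq0 symd_eq0.
    have : ~~ odd #|B :+: A| by rewrite odd_symd (negPf B_even) (negPf A_even).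
    by case: #|_| => [|[]].
  have cZ : #|Z| = 2.
    by apply/anti_leq; rewrite Z2 (leq_trans BA2 (subset_leq_card BAZ)).
  split=> //; have <- : B :+: A = Z by apply/eqP; rewrite eqEcard BAZ cZ.
  by rewrite symdC symdK.
have A_half : A \in halfv A Z by rewrite inE A_even symdv sub0set.
have [/eqP/cards2P[y [z [yz ZE]]]|Zn2] := eqVneq #|Z| 2; last first.
  exists (false, A :+: [set x0]%SET, [set x0]%SET).
    by rewrite /valid /= oddA1.
  apply/setP => B; rewrite /fverts /simplexv /= imset_set1 symdK in_set1.
  apply/idP/eqP => [BH|->//]; apply/eqP; apply/negPn/negP => /(small _ BH)[_ Z2'].
  by rewrite Z2' in Zn2.
exists (false, A :+: [set y]%SET, Z); first by rewrite /valid /= oddA1.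
have AyzE : A :+: [set y]%SET :+: [set z]%SET = A :+: Z.
  apply/setP => x; rewrite !in_symd ZE !inE -addbA; congr (_ (+) _).
  by have [->|] := eqVneq x y; rewrite ?(negPf yz).
apply/setP => B; rewrite /fverts /=; apply/idP/imsetP => [BH|[x]].
  have [->|/(small _ BH)[-> _]] := eqVneq B A.
    by exists y; rewrite ?symdK // ZE set21.
  by exists z; rewrite ?AyzE // ZE set22.
rewrite {1}ZE !inE => /pred2P[] -> ->; first by rewrite symdK A_even symdv sub0set.
have cZ2 : #|Z| = 2 by rewrite ZE cards2 yz.
by rewrite AyzE odd_symd (negPf A_even) cZ2 symdC symdKl subxx.
Qed.

End FaceCodes.

(** * Convex hulls, supporting forms and affine independence *)

Section ConvexGeometry.
Local Open Scope ring_scope.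
Context {R : realType} {d : nat}.
Implicit Types (x y c : 'rV[R]_d) (P F V : set 'rV[R]_d).
Local Open Scope classical_set_scope.

Lemma dotC x y : dot x y = dot y x.
Proof. by apply: eq_bigr => i _; rewrite mulrC. Qed.

Lemma dotDr c x y : dot c (x + y) = dot c x + dot c y.
Proof. by rewrite -big_split; apply: eq_bigr => i _; rewrite mxE mulrDr. Qed.

Lemma dotZr c (a : R) x : dot c (a *: x) = a * dot c x.
Proof. by rewrite mulr_sumr; apply: eq_bigr => i _; rewrite mxE mulrCA. Qed.

Lemma dotNr c x : dot c (- x) = - dot c x.
Proof. by rewrite -scaleN1r dotZr mulN1r. Qed.

Lemma dotNl x y : dot (- x) y = - dot x y.
Proof. by rewrite dotC dotNr dotC. Qed.

Lemma dotBr c x y : dot c (x - y) = dot c x - dot c y.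
Proof. by rewrite dotDr dotNr. Qed.

Lemma dot0r c : dot c 0 = 0.
Proof. by rewrite /dot big1 // => i _; rewrite mxE mulr0. Qed.

Lemma dot_sumr (I : finType) c (x : I -> 'rV[R]_d) :
  dot c (\sum_i x i) = \sum_i dot c (x i).
Proof.
apply: (big_ind2 (fun u v => dot c u = v)) => [|u1 v1 u2 v2 <- <-|//].
  exact: dot0r.
exact: dotDr.
Qed.

Lemma dotE x y : dot x y = (x *m y^T) 0 0.
Proof. by rewrite mxE; apply: eq_bigr => i _; rewrite mxE. Qed.

Lemma dot_ge0 x : 0 <= dot x x.
Proof. by apply: sumr_ge0 => i _; rewrite -expr2 sqr_ge0. Qed.

Lemma convex_hull_sub V : V `<=` convex_hull V.
Proof.
move=> x Vx; exists 1%N, (fun=> x), (fun=> 1); split=> //.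
  by rewrite big_ord1.
by rewrite big_ord1 scale1r.
Qed.

Lemma convex_hullS V F : V `<=` F -> convex_hull V `<=` convex_hull F.
Proof. by move=> VF x [n [p [w [Vp w0 w1 xE]]]]; exists n, p, w; split=> //; auto. Qed.

Lemma dot_convex_hull_le V c (b : R) :
  (forall v, V v -> dot c v <= b) -> forall x, convex_hull V x -> dot c x <= b.
Proof.
move=> Vb _ [n [p [w [Vp w0 w1 ->]]]].
rewrite dot_sumr -[b]mul1r -w1 mulr_suml; apply: ler_sum => k _.
by rewrite dotZr ler_wpM2l // Vb.
Qed.

(** In a convex combination with value [b] the nonnegative slacks [w k * (b - dot c (p k))] sum to
    zero, so each vanishes and the points of nonzero weight lie on the face. *)
Lemma convex_hull_face V c (b : R) : (forall v, V v -> dot c v <= b) ->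
  convex_hull V `&` [set x | dot c x = b] =
  convex_hull (V `&` [set x | dot c x = b]).
Proof.
move=> Vb; apply/seteqP; split=> [x|x xF]; last first.
  split; first by apply: convex_hullS xF => v [].
  case: xF => n [p [w [Vp w0 w1 ->]]] /=.
  rewrite dot_sumr -[b]mul1r -w1 mulr_suml; apply: eq_bigr => k _.
  by rewrite dotZr; case: (Vp k) => _ ->.
case=> -[n [p [w [Vp w0 w1 xE]]]] /= cx.
have slack0 k : w k * (b - dot c (p k)) = 0.
  have slack_ge0 j : 0 <= w j * (b - dot c (p j)).
    by rewrite mulr_ge0 // subr_ge0 Vb.
  have /eqP : \sum_j w j * (b - dot c (p j)) = 0.
    under eq_bigr do rewrite mulrBr -dotZr.
    by rewrite sumrB -mulr_suml w1 mul1r -dot_sumr -xE cx subrr.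
  by rewrite psumr_eq0 // => /allP/(_ k (mem_index_enum k))/eqP.
have on_face k : w k != 0 -> dot c (p k) = b.
  move=> wk; apply/eqP; rewrite eq_sym -subr_eq0.
  by have /eqP := slack0 k; rewrite mulf_eq0 (negPf wk).
have [k0 wk0] : exists k, w k != 0.
  apply: contrapT => /forallNP w_0.
  have := @oner_neq0 R; rewrite -w1 big1 ?eqxx // => k _.
  by apply/eqP; apply: contra_notT (w_0 k).
(* Points of weight zero may lie off the face, so they are replaced by a point of nonzero weight. *)
exists n, (fun k => if w k == 0 then p k0 else p k), w; split=> // [k|].
  by case: eqP => /eqP wk; split=> //=; apply: on_face.
by rewrite xE; apply: eq_bigr => k _; case: eqP => // ->; rewrite !scale0r.
Qed.

Lemma is_face_sub P F : is_face P F -> F `<=` P.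
Proof. by move=> [c [b [_ ->]]] x []. Qed.

(** The form [c] vanishes on differences of points of [F] but not on [x - p ord0]. Applied to a
    linear relation it shows that the last coefficient is zero; the independence of [p] deals with
    the others. *)
Lemma affinely_independent_extend n (p : 'I_n.+1 -> 'rV[R]_d) P F x :
  is_face P F -> affinely_independent p -> (forall k, F (p k)) ->
  P x -> ~ F x ->
  affinely_independent
    (fun k : 'I_n.+2 => if (k <= n)%N then p (inord k) else x).
Proof.
move=> [c [b [Pb FE]]] p_ind Fp Px Fx.
have cp k : dot c (p k) = b by have := Fp k; rewrite FE => -[].
have cx : dot c x - b != 0.
  by rewrite subr_eq0; apply/eqP => cxb; apply: Fx; rewrite FE.
have inord0 : inord 0 = ord0 :> 'I_n.+1 by apply/val_inj; rewrite /= inordK.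
apply: inj_row_free => v; set M := (X in v *m X).
have rowE (i : 'I_n) : row (widen_ord (leqnSn n) i) M =
    row i (\matrix_(i < n) (p (lift ord0 i) - p ord0)).
  rewrite !rowK /= inord0 /bump /= add1n ltn_ord; congr (p _ - _).
  by apply/val_inj; rewrite /= inordK // ltnS.
have row_max : row ord_max M = x - p ord0 by rewrite rowK /= ltnn inord0.
rewrite mulmx_sum_row big_ord_recr /= row_max => v0.
have vmax : v 0 ord_max = 0.
  apply/eqP; rewrite -[_ == 0]orbF -(negPf cx) -mulf_eq0.
  have := congr1 (dot c) v0; rewrite dot0r dotDr dotZr dotBr cp dot_sumr.
  rewrite big1 ?add0r => [->|i _]; first by rewrite eqxx.
  by rewrite dotZr rowE rowK dotBr !cp subrr mulr0.
have vlt : (\row_i v 0 (widen_ord (leqnSn n) i)) = 0.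
  apply: (row_free_inj p_ind); rewrite mul0mx -[RHS]v0 vmax scale0r addr0.
  by rewrite mulmx_sum_row; apply: eq_bigr => i _; rewrite mxE rowE.
apply/rowP => i; rewrite mxE.
have [|] := ltnP i n => ltin.
  by have /rowP/(_ (Ordinal ltin)) := vlt; rewrite !mxE => <-; congr (v _ _); apply/val_inj.
by rewrite -vmax; congr (v _ _); apply/val_inj/anti_leq; rewrite /= ltin -ltnS ltn_ord.
Qed.

Lemma affinely_independent1 (p : 'I_1 -> 'rV[R]_d) : affinely_independent p.
Proof. by apply: inj_row_free => v _; apply/rowP => -[]. Qed.

Lemma affinely_independent_leq n (p : 'I_n.+1 -> 'rV[R]_d) :
  affinely_independent p -> (n <= d)%N.
Proof. by move=> /eqP <-; exact: rank_leq_col. Qed.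

Lemma has_dim_inj F m n : has_dim F m -> has_dim F n -> m = n.
Proof.
move=> [[p [pi Fp]] m_max] [[q [qi Fq]] n_max].
by apply/anti_leq; rewrite (m_max _ q) ?(n_max _ p).
Qed.

Definition hvec (A : {set 'I_d}) : 'rV[R]_d := \row_i (i \in A)%:R.

Definition hullv (W : {set {set 'I_d}}) : set 'rV[R]_d :=
  convex_hull (hvec @` [set` W]).

Lemma half_cube_verticesE :
  half_cube_vertices R d = hvec @` [set` [set A : {set 'I_d} | ~~ odd #|A|]%SET].
Proof.
apply/seteqP; split=> [x [x01 x_even]|_ [A + <-]] /=; last first.
  rewrite /= inE => A_even; split.
    by move=> i; rewrite mxE; case: (i \in A); [right | left].
  congr (~~ odd _): A_even; apply: eq_card => i.
  by rewrite !inE mxE; case: (i \in A); rewrite ?eqxx // eq_sym oner_eq0.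
exists [set i | x 0 i == 1]%SET; first by rewrite /= inE.
apply/rowP => i; rewrite mxE inE.
by case: (x01 i) => ->; rewrite ?eqxx // eq_sym oner_eq0.
Qed.

Lemma half_cubeE : half_cube R d = hullv [set A : {set 'I_d} | ~~ odd #|A|]%SET.
Proof. by rewrite /half_cube half_cube_verticesE. Qed.

Lemma hullvS (W W' : {set {set 'I_d}}) : W \subset W' -> hullv W `<=` hullv W'.
Proof.
move=> /fintype.subsetP WW'; apply: convex_hullS => _ [A AW <-].
by exists A => //; exact: WW'.
Qed.

Lemma hullv_hvec (W : {set {set 'I_d}}) A : A \in W -> hullv W (hvec A).
Proof. by move=> AW; apply: convex_hull_sub; exists A. Qed.

Lemma hullv_face (W : {set {set 'I_d}}) c (b : R) :
  (forall A, A \in W -> dot c (hvec A) <= b) ->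
  hullv W `&` [set x | dot c x = b] =
  hullv [set A in W | dot c (hvec A) == b]%SET.
Proof.
move=> Wb; rewrite /hullv convex_hull_face => [|_ [A AW <-]]; last exact: Wb.
congr convex_hull; apply/seteqP; split=> [_ [[A AW <-] /= /eqP cA]|_ [A + <-]].
  by exists A => //=; rewrite inE; apply/andP.
by rewrite /= inE => /andP[AW /eqP cA]; split=> //; exists A.
Qed.

Lemma dot_hvec_symd c (a : 'I_d -> R) (A u : {set 'I_d}) :
  (forall i, c 0 i = if i \in u then a i else - a i) ->
  dot c (hvec A) = dot c (hvec u) - \sum_(i in A :+: u) a i.
Proof.
move=> cE; rewrite /dot [X in _ - X]big_mkcond -sumrB; apply: eq_bigr => i _.
rewrite !mxE cE in_symd; case: (i \in A); case: (i \in u) => /=;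
  by rewrite ?mulr1 ?mulr0 ?subr0 ?subrr ?sub0r ?opprK.
Qed.

Lemma hvec_dist (A B : {set 'I_d}) :
  dot (hvec A - hvec B) (hvec A - hvec B) = #|A :+: B|%:R.
Proof.
rewrite -sum1_card natr_sum big_mkcond; apply: eq_bigr => i _.
rewrite !mxE in_symd; case: (i \in A); case: (i \in B) => /=;
  by rewrite ?subrr ?subr0 ?sub0r ?mulr0 ?mulr1 ?mulrNN ?mulr1.
Qed.

End ConvexGeometry.

(** * Faces of the half-cube and their codes *)

Section HalfCubeFaces.
Local Open Scope ring_scope.
Context {R : realType} {d : nat}.
Import boot.fintype boot.finset.
Implicit Types (A B u v M N Z : {set 'I_d}) (c : bool * {set 'I_d} * {set 'I_d}).
Local Open Scope classical_set_scope.

Local Notation P := (half_cube R d).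

Definition cface c : set 'rV[R]_d := hullv (fverts c).

(** The form falls from its value at [u] by the total weight of [A :+: u]. For a half-cube the
    weights are 0 on [M] and 1 off it, and the bound is the value at [u]. For a simplex they are 1
    on [M] and 2 off it; as [A :+: u] has odd size, the fall is at least 1, with equality exactly
    for a single element of [M]. *)
Lemma fverts_support c : valid c ->
  exists (w : 'rV[R]_d) (b : R), forall A, ~~ odd #|A| ->
    dot w (hvec A) <= b /\ (dot w (hvec A) == b) = (A \in fverts c).
Proof.
case: c => [[h u] M] /andP[/= uo _].
pose a i : nat := (~~ h + (i \notin M))%N.
exists (\row_i if i \in u then (a i)%:R else - (a i)%:R).
exists (dot (\row_i if i \in u then (a i)%:R else - (a i)%:R) (hvec u) - (~~ h)%:R).
move=> A Ae; rewrite (dot_hvec_symd (a := fun i => (a i)%:R) A (u := u)); last first.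
  by move=> i; rewrite mxE.
rewrite lerD2l lerN2 (can_eq (addKr _)) eqr_opp -natr_sum ler_nat eqr_nat.
have -> : (\sum_(i in A :+: u) a i)%N = (~~ h * #|A :+: u| + #|(A :+: u) :\: M|)%N.
  rewrite big_split /= sum_nat_const mulnC; congr addn.
  rewrite -sum1_card [RHS]big_mkcond [LHS]big_mkcond; apply: eq_bigr => i _.
  by rewrite in_setD andbC; case: (i \in A :+: u); case: (i \in M).
case: h a => a /=; rewrite ?mul0n ?add0n.
  by split=> //; rewrite cards_eq0 setD_eq0 inE Ae.
have Au_gt0 : (0 < #|A :+: u|)%N.
  have : odd #|A :+: u| by rewrite odd_symd (negPf Ae) uo.
  by case: #|_|.
rewrite mul1n; split; first exact: ltn_addr.
have -> : (#|A :+: u| + #|(A :+: u) :\: M| == 1)%N =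
    (#|A :+: u| == 1)%N && (A :+: u \subset M).
  rewrite -setD_eq0 -cards_eq0; case: #|A :+: u| Au_gt0 => [|[|k]] // _.
apply/andP/imsetP => [[/cards1P[i AuE]]|[i iM ->]].
  by rewrite AuE sub1set => iM; exists i => //; rewrite -AuE symdC symdK.
by rewrite symdC symdKl cards1 sub1set.
Qed.

Lemma half_cube_hvec A : ~~ odd #|A| -> P (hvec A).
Proof. by move=> Ae; rewrite half_cubeE; apply: hullv_hvec; rewrite inE. Qed.

Lemma dot_half_cube_le (w : 'rV[R]_d) (b : R) :
  (forall A, ~~ odd #|A| -> dot w (hvec A) <= b) ->
  forall x, P x -> dot w x <= b.
Proof.
move=> wb; rewrite half_cubeE; apply: dot_convex_hull_le => _ [A + <-].
by rewrite /= inE; exact: wb.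
Qed.

Lemma half_cube_faceE (w : 'rV[R]_d) (b : R) :
  (forall A, ~~ odd #|A| -> dot w (hvec A) <= b) ->
  P `&` [set x | dot w x = b] =
  hullv [set A : {set 'I_d} | ~~ odd #|A| & dot w (hvec A) == b]%SET.
Proof.
move=> wb; rewrite half_cubeE hullv_face; last by move=> A; rewrite inE => /wb.
by congr hullv; apply/setP => A; rewrite !inE.
Qed.

Lemma cface_is_face c : valid c -> is_face P (cface c).
Proof.
move=> vc; have [w [b wb]] := fverts_support vc.
exists w, b; split; first by apply: dot_half_cube_le => A /wb[].
rewrite half_cube_faceE; last by move=> A /wb[].
congr hullv; apply/setP => A; rewrite inE.
have [/wb[_ ->]//|/negPf Ao] := boolP (~~ odd #|A|).
by apply: contraFF Ao; exact: even_fverts.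
Qed.

(** The supporting form is constant on the face, and among the even sets it takes that value only on
    those of [fverts c]. So the convex hull contains no further vertex. *)
Lemma cface_hvec c A : valid c -> ~~ odd #|A| ->
  cface c (hvec A) -> A \in fverts c.
Proof.
move=> vc Ae; have [w [b wb]] := fverts_support vc.
suff fb x : cface c x -> dot w x = b.
  by move=> /fb cA; rewrite -(wb A Ae).2 cA.
move=> cx; apply/le_anti/andP; split.
  by apply: dot_half_cube_le (is_face_sub (cface_is_face vc) cx) => B /wb[].
rewrite -lerN2 -dotNl; apply: dot_convex_hull_le cx => _ [B /= Bc <-].
by rewrite dotNl lerN2 (eqP (_ : dot w (hvec B) == b)) // (wb B (even_fverts vc Bc)).2.
Qed.

Lemma cfaceS c1 c2 : valid c1 -> valid c2 ->
  (cface c1 `<=` cface c2) <-> fverts c1 \subset fverts c2.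
Proof.
move=> v1 v2; split=> [sub|]; last exact: hullvS.
apply/subsetP => A Ac1; have Ae := even_fverts v1 Ac1.
by apply: cface_hvec => //; apply: sub; exact: hullv_hvec.
Qed.

Lemma cface_inj c1 c2 : valid c1 -> valid c2 ->
  cface c1 = cface c2 -> fverts c1 = fverts c2.
Proof.
move=> v1 v2 c12; apply/eqP; rewrite eqEsubset.
by apply/andP; split; apply/cfaceS => //; rewrite c12.
Qed.

Lemma cface_proper c1 c2 : valid c1 -> valid c2 ->
  (cface c1 `<` cface c2) <-> fverts c1 \proper fverts c2.
Proof.
move=> v1 v2; rewrite properE /classical_sets.proper !cfaceS //.
by split=> [[-> /negP]|/andP[-> /negP]].
Qed.

(** The face consists of the even [A] for which the weight [s A] is minimal. If an even set has
    weight 0, the face is the half-cube over the directions of weight 0. Otherwise [u] is odd and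
    all weights are positive, since [u] or some [u :+: [set i]] would be an even set of weight 0;
    then only single directions can be minimal. *)
Lemma is_face_code F : (0 < d)%N -> is_face P F ->
  exists2 c, valid c & F = cface c.
Proof.
move=> d_gt0 [w [b [wb FE]]]; pose x0 := Ordinal d_gt0.
have {}wb A : ~~ odd #|A| -> dot w (hvec A) <= b.
  by move=> /half_cube_hvec/wb.
rewrite {}FE half_cube_faceE //; set E := [set A | _ & _]%SET.
suff [c vc ->] : exists2 c, valid c & E = fverts c by exists c.
have [->|[A0 A0E]] := set_0Vmem E.
  exists (false, [set x0]%SET, finset.set0); first by rewrite /valid /= cards1.
  by rewrite /fverts /simplexv /= imset0.
pose a i : R := `|w 0 i|; pose u : {set 'I_d} := [set i | 0 < w 0 i]%SET.
have a_ge0 i : 0 <= a i by exact: normr_ge0.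
have wE i : w 0 i = if i \in u then a i else - a i.
  rewrite /a inE; case: ifP => [/gtr0_norm->//|/negbT]; rewrite -leNgt => w_le0.
  by rewrite ler0_norm // opprK.
pose s A : R := \sum_(i in A :+: u) a i; pose b' := dot w (hvec u) - b.
have dotwE A : dot w (hvec A) = dot w (hvec u) - s A.
  by rewrite (dot_hvec_symd _ wE).
have b'_le A : ~~ odd #|A| -> b' <= s A.
  by move=> /wb; rewrite dotwE lerBlDr addrC -lerBlDr.
have EE A : (A \in E) = ~~ odd #|A| && (s A == b').
  rewrite inE dotwE; congr (_ && _).
  rewrite /b' subr_eq -[in RHS]subr_eq0 -[in LHS]subr_eq0 -[in LHS]oppr_eq0.
  by congr (_ == 0); ring.
have [A0e /eqP sA0] := andP (etrans (esym (EE A0)) A0E).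
have s_ge0 A : 0 <= s A by exact: sumr_ge0.
have [[A1 A1e sA1]|no_zero] := pselect (exists2 A1 : {set 'I_d}, ~~ odd #|A1| & s A1 = 0).
  have b'0 : b' = 0.
    by apply/le_anti; rewrite -{1}sA1 b'_le // -sA0 s_ge0.
  have EH : E = halfv u [set i | a i == 0]%SET.
    apply/setP => A; rewrite EE inE; congr (_ && _); rewrite b'0 psumr_eq0 //.
    apply/allP/subsetP => [az i iA|az i _]; last by apply/implyP => /az; rewrite inE.
    by rewrite inE; apply: (implyP (az i (mem_index_enum i))).
  by rewrite EH in A0E *; apply: fverts_halfv A0E.
have uo : odd #|u|.
  apply: contra_notT no_zero => ue; exists u => //.
  by rewrite /s symdv big_set0.
have a_gt0 i : 0 < a i.
  rewrite lt_def a_ge0 andbT; apply: contra_notN no_zero => /eqP ai0.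
  exists (u :+: [set i]%SET); first by rewrite odd_symd uo cards1.
  by rewrite /s symdC symdKl big_set1.
have s1 i : s (u :+: [set i]%SET) = a i by rewrite /s symdC symdKl big_set1.
have b'_min i : b' <= a i by rewrite -s1 b'_le // odd_symd uo cards1.
exists (false, u, [set i | a i == b']%SET); first by rewrite /valid /= uo.
apply/setP => A; rewrite EE; apply/andP/imsetP => [[Ae /eqP sA]|[i + ->]]; last first.
  by rewrite inE s1 odd_symd uo cards1.
have /card_gt0P[i iA] : (0 < #|A :+: u|)%N.
  have : odd #|A :+: u| by rewrite odd_symd (negPf Ae) uo.
  by case: #|_|.
(* A second element [k] would push [s A], which is [b'], strictly above [a i], contrary to
   [b'_min]. *)
have AuE : A :+: u = [set i]%SET.
  apply/eqP; rewrite eq_sym eqEsubset sub1set iA; apply/subsetP => k kA.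
  rewrite inE; apply/negPn/negP => ki; have := b'_min i; rewrite leNgt => /negP; apply.
  rewrite -sA /s (bigD1 i) //= ltrDl (bigD1 k) /=; last by rewrite kA.
  by rewrite ltr_wpDr // sumr_ge0.
exists i; last by rewrite -AuE symdC symdK.
by rewrite inE -s1 -AuE symdC symdK sA.
Qed.

End HalfCubeFaces.

(** * Rank of a code and dimension of its face *)

Section HalfCubeDimensions.
Local Open Scope ring_scope.
Context {R : realType} {d : nat} (hd : (2 < d)%N).
Import boot.fintype boot.finset.
Implicit Types (A B u v M N Z : {set 'I_d}) (c : bool * {set 'I_d} * {set 'I_d}).
Local Open Scope classical_set_scope.

Local Notation P := (half_cube R d).

Lemma halfvT u : halfv u [set: 'I_d]%SET = [set A : {set 'I_d} | ~~ odd #|A|]%SET.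
Proof. by apply/setP => A; rewrite !inE subsetT andbT. Qed.

Lemma valid_top u : odd #|u| -> valid (true, u, [set: 'I_d]%SET).
Proof. by move=> uo; rewrite /valid uo cardsT card_ord. Qed.

Lemma cface_top u : cface (true, u, [set: 'I_d]%SET) = P.
Proof. by rewrite half_cubeE /cface /fverts halfvT. Qed.

Lemma frank_full c : frank c = d.+1 -> cface c = P.
Proof.
case: c => [[h u] M]; rewrite /frank /= => cM.
have Md : (#|M| <= d)%N by rewrite -[leqRHS]card_ord max_card.
case: h cM => [|cM]; last by move: Md; rewrite addn0 in cM; rewrite cM ltnn.
rewrite addn1 => -[cM]; rewrite -(cface_top u); congr cface; congr (_, _).
by apply/eqP; rewrite eqEcard subsetT cardsT card_ord cM /=.
Qed.

Lemma frank_gt0 c : valid c -> (0 < frank c)%N -> exists A, A \in fverts c.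
Proof.
case: c => [[[] u] M] /andP[/= uo M3]; rewrite /frank /fverts /= ?addn0 => c_gt0.
  have /card_gt0P[i iM] : (0 < #|M|)%N by exact: leq_trans M3.
  by exists (u :+: [set i]%SET); rewrite mem_halfv1.
have /card_gt0P[i iM] := c_gt0.
by exists (u :+: [set i]%SET); rewrite mem_simplexv1.
Qed.

Lemma frank_down c r : valid c -> frank c = r.+1 ->
  exists c', [/\ valid c', frank c' = r & fverts c' \subset fverts c].
Proof.
case: c => [[[] u] M] /andP[/= uo M3]; rewrite /frank /= ?addn1 ?addn0.
  move=> [cM]; exists (false, u, M).
  by rewrite /valid /frank /= uo addn0; split=> //; exact: simplexv_half.
move=> cM; have /card_gt0P[i iM] : (0 < #|M|)%N by rewrite cM.
exists (false, u, M :\ i); rewrite /valid /frank /= uo addn0; split=> //.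
  by apply: succn_inj; rewrite -cM (cardsD1 i M) iM.
by rewrite /fverts /= simplexvS subsetDl.
Qed.

Lemma frank_up c : valid c -> (frank c <= d)%N ->
  exists c', [/\ valid c', frank c' = (frank c).+1 & fverts c \subset fverts c'].
Proof.
case: c => [[h u] M] /andP[/= uo M3] cd.
have [ME|] := eqVneq M [set: 'I_d]%SET.
  move: cd; rewrite {1}/frank /= {1}ME cardsT card_ord.
  case: h M3 => M3; first by rewrite addn1 ltnn.
  move=> _; exists (true, u, M); rewrite /valid /frank /= uo ME cardsT card_ord.
  by rewrite addn1 addn0; split=> //; exact: simplexv_half.
rewrite -subTset => /subsetPn[i _ iM].
exists (h, u, i |: M); rewrite /valid /frank /= uo cardsU1 iM; split=> //.
  by case: h M3 {cd} => //= M3; rewrite add1n ltnW.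
rewrite /fverts /=; case: h {M3 cd}; first by rewrite halfvS // subsetUr.
by rewrite simplexvS subsetUr.
Qed.

Lemma cface_notin c1 c2 : valid c1 -> valid c2 -> (frank c1 < frank c2)%N ->
  fverts c1 \subset fverts c2 ->
  exists x : 'rV[R]_d, cface c2 x /\ ~ cface c1 x.
Proof.
move=> v1 v2 r12 sub; have : ~~ (fverts c2 \subset fverts c1).
  by apply: contraL r12 => /(frank_sub v2 v1)[le_r _]; rewrite -leqNgt.
case/subsetPn => A A2 A1; exists (hvec A); split; first exact: hullv_hvec.
by apply: contraNnot A1 => /(cface_hvec v1); apply; exact: even_fverts A2.
Qed.

Lemma cface_points c n : valid c -> frank c = n.+1 ->
  exists p : 'I_n.+1 -> 'rV[R]_d,
    affinely_independent p /\ forall k, cface c (p k).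
Proof.
elim: n c => [|n IHn] c vc rc.
  have [|A Ac] := frank_gt0 vc; first by rewrite rc.
  exists (fun=> hvec A); split; first exact: affinely_independent1.
  by move=> _; exact: hullv_hvec.
have [c' [vc' rc' sub]] := frank_down vc rc.
have [p [p_ind pc']] := IHn c' vc' rc'.
have [|x [xc xc']] := cface_notin vc' vc _ sub; first by rewrite rc rc'.
exists (fun k => if (k <= n)%N then p (inord k) else x); split.
  exact: affinely_independent_extend (cface_is_face vc') p_ind pc'
    (is_face_sub (cface_is_face vc) xc) xc'.
by move=> k; case: ifP => // _; apply: hullvS sub _ _; exact: pc'.
Qed.

(** The bound comes from the ambient space: a point of a face of the next rank extends the family,
    and at rank [d.+1] no independent family has more than [d.+1] points. *)
Lemma cface_points_leq c n (p : 'I_n.+1 -> 'rV[R]_d) : valid c ->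
  affinely_independent p -> (forall k, cface c (p k)) -> (n < frank c)%N.
Proof.
move=> vc; move: {2}(d.+1 - frank c)%N (erefl (d.+1 - frank c)%N) => e.
elim: e c n p vc => [|e IHe] c n p vc ce p_ind pc.
  rewrite (leq_trans _ (_ : d.+1 <= _)%N) // ?ltnS ?(affinely_independent_leq p_ind) //.
  by rewrite -subn_eq0 ce.
have cd : (frank c <= d)%N.
  by rewrite leqNgt; apply/negP => dc; move: ce; rewrite (eqP (_ : _ - _ == 0)%N).
have [c' [vc' rc' sub]] := frank_up vc cd.
have [|x [xc' xc]] := cface_notin vc vc' _ sub; first by rewrite rc'.
rewrite -ltnS -rc'; apply: (IHe _ _ _ vc' _
  (affinely_independent_extend (cface_is_face vc) p_ind pc
    (is_face_sub (cface_is_face vc') xc') xc)).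
  by rewrite rc' subSS; move: ce; rewrite subSn // => -[].
by move=> k; case: ifP => // _; apply: hullvS sub _ _; exact: pc.
Qed.

Lemma has_dim_cface c : valid c -> (0 < frank c)%N ->
  has_dim (cface c : set 'rV[R]_d) (frank c).-1.
Proof.
move=> vc c_gt0; split; first by apply: cface_points; rewrite ?prednK.
by move=> m p p_ind pc; rewrite -ltnS prednK // (cface_points_leq vc p_ind pc).
Qed.

Lemma frank_has_dim c n : valid c -> has_dim (cface c : set 'rV[R]_d) n ->
  frank c = n.+1.
Proof.
move=> vc c_dim; have c_gt0 : (0 < frank c)%N.
  by have [[p [p_ind pc]] _] := c_dim; exact: leq_trans (cface_points_leq vc p_ind pc).
by rewrite -(has_dim_inj (has_dim_cface vc c_gt0) c_dim) prednK.
Qed.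

Lemma proper_nonempty_cface c : valid c -> (0 < frank c <= d)%N ->
  proper_nonempty_face P (cface c).
Proof.
move=> vc /andP[c_gt0 cd]; split; first exact: cface_is_face.
  by have [A Ac] := frank_gt0 vc c_gt0; exists (hvec A); exact: hullv_hvec.
have x0 : 'I_d by exists 0%N; apply: leq_trans hd.
have vt := valid_top (u := [set x0]%SET); rewrite cards1 in vt.
rewrite -(cface_top [set x0]%SET) => /(cface_inj vc (vt isT)).
move=> /(frank_eq vc (vt isT)) rc; move: cd.
by rewrite rc /frank /= cardsT card_ord addn1 ltnn.
Qed.

End HalfCubeDimensions.

(** * Chains of direction sets and codes of flags *)

Section FlagParameters.
Local Open Scope ring_scope.
Context {d : nat}.
Import boot.fintype boot.finset.
Implicit Types (u : {set 'I_d}) (s : {perm 'I_d}) (N : nat -> {set 'I_d}).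

(** A complete chain of subsets is the order in which the elements appear. [s x] is the position of
    [x], so chains are counted as permutations. *)
Definition below s (j : nat) : {set 'I_d} := [set x | s x < j]%N.

Lemma card_below s j : (j <= d)%N -> #|below s j| = j.
Proof.
move=> jd; have -> : below s j = s @^-1: [set widen_ord jd i | i : 'I_j].
  apply/setP => x; rewrite !inE; apply/idP/imsetP => [sx|[i _ ->]]; last exact: (ltn_ord i).
  by exists (Ordinal sx) => //; exact/val_inj.
rewrite on_card_preimset; last by apply: onW_bij; apply: injF_bij; exact: perm_inj.
by rewrite card_imset ?card_ord // => i j' /(congr1 val)/= /val_inj.
Qed.

Lemma below_d s : below s d = [set: 'I_d].
Proof. by apply/eqP; rewrite eqEcard subsetT cardsT card_ord card_below /=. Qed.

Lemma belowS s i j : (i <= j)%N -> below s i \subset below s j.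
Proof. by move=> ij; apply/subsetP => x; rewrite !inE => /leq_trans->. Qed.

Lemma below_inj s s' : (forall j, (j <= d)%N -> below s j = below s' j) -> s = s'.
Proof.
move=> eq_b; apply/permP => x; apply/val_inj/anti_leq => /=.
have sle (t t' : {perm 'I_d}) : (forall j, (j <= d)%N -> below t j = below t' j) ->
    (t' x <= t x)%N.
  by move=> /(_ (t x).+1 (ltn_ord _))/setP/(_ x); rewrite !inE ltnSn ltnS => <-.
by rewrite !sle // => j jd; rewrite eq_b.
Qed.

(** The position of [x] is the least [j] with [x] in [N j.+1]; positions are distinct because each
    step of the chain adds a single element. *)
Lemma below_full N : (forall j, (j <= d)%N -> #|N j| = j) ->
  (forall j, (j < d)%N -> N j \subset N j.+1) ->
  exists s, forall j, (j <= d)%N -> N j = below s j.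
Proof.
move=> cN subN.
have monoN i j : (i <= j <= d)%N -> N i \subset N j.
  elim: j => [|j IHj]; first by rewrite leqn0 => /andP[/eqP->].
  rewrite leq_eqVlt => /andP[/predU1P[->//|ij] jd].
  by rewrite (subset_trans (IHj _) (subN _ jd)) // -ltnS ij ltnW.
have inN x : exists j, x \in N j.+1.
  case: d x N cN subN monoN => [[]//|n] x N0 cN0 _ _; exists n.
  suff -> : N0 n.+1 = [set: 'I_n.+1] by rewrite in_setT.
  by apply/eqP; rewrite eqEcard subsetT cardsT card_ord cN0 /=.
have rk_lt x : (ex_minn (inN x) < d)%N.
  case: ex_minnP => m _ m_min; case: d x N cN subN monoN inN m m_min => [[]//|n].
  move=> x N0 cN0 _ _ _ m m_min; rewrite ltnS m_min //.
  suff -> : N0 n.+1 = [set: 'I_n.+1] by rewrite in_setT.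
  by apply/eqP; rewrite eqEcard subsetT cardsT card_ord cN0 /=.
pose rk x := Ordinal (rk_lt x).
have rkE x j : (j <= d)%N -> (x \in N j) = (rk x < j)%N.
  rewrite /=; case: ex_minnP => m xm m_min jd; apply/idP/idP => [|mj]; last first.
    by apply: (subsetP (monoN m.+1 j _)) => //; rewrite mj.
  case: j jd => [|j jd /m_min//]; move=> _.
  by have /eqP := cN 0%N (leq0n _); rewrite cards_eq0 => /eqP->; rewrite inE.
have rk_inj : injective rk.
  move=> x y xy; have xd := ltn_ord (rk x).
  have /eqP/cards1P[z zE] : #|N (rk x).+1 :\: N (rk x)| = 1%N.
    by rewrite cardsD (setIidPr (subN _ xd)) !cN ?subSnn // ltnW.
  have xz : x \in [set z] by rewrite -zE in_setD !rkE ?ltnn ?ltnSn // ltnW.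
  have yz : y \in [set z] by rewrite -zE in_setD !rkE -?xy ?ltnn ?ltnSn // ltnW.
  by move: xz yz; rewrite !inE => /eqP-> /eqP->.
by exists (perm rk_inj) => j jd; apply/setP => x; rewrite rkE // inE permE.
Qed.

(** The rank [j] runs from 0 to [d.+1], so the empty face and the whole polytope are included. A
    half-cube of rank [j] has [j.-1] directions, so the set of size [k] serves both rank [k] and
    rank [k.+1]. *)
Definition flag_code (k : nat) u s (j : nat) : bool * {set 'I_d} * {set 'I_d} :=
  if (j <= k)%N then (false, u, below s j) else (true, u, below s j.-1).

Lemma frank_flag_code k u s j : (k <= d)%N -> (j <= d.+1)%N ->
  frank (flag_code k u s j) = j.
Proof.
move=> kd jd; rewrite /flag_code /frank.
case: (leqP j k) => [jk|] /=; first by rewrite addn0 card_below // (leq_trans jk).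
by case: j jd => // j jd _; rewrite card_below // addn1.
Qed.

Lemma valid_flag_code k u s j : (2 < k <= d)%N -> odd #|u| -> (j <= d.+1)%N ->
  valid (flag_code k u s j).
Proof.
move=> /andP[k3 kd] uo jd; rewrite /flag_code /valid.
case: (leqP j k) => [_|] /=; rewrite uo //; case: j jd => // j jd kj.
by rewrite card_below //; exact: leq_trans k3 _.
Qed.

Lemma flag_codeS k u s i j : odd #|u| -> (i <= j)%N ->
  fverts (flag_code k u s i) \subset fverts (flag_code k u s j).
Proof.
move=> uo ij; rewrite /flag_code; case: (leqP i k) => ik; case: (leqP j k) => jk;
  rewrite /fverts /=.
- by rewrite simplexvS belowS.
- apply: subset_trans (simplexv_half _ uo); rewrite simplexvS belowS //.
  by case: j jk {ij} => // j; rewrite ltnS; exact: leq_trans.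
- by have := leq_trans ik (leq_trans ij jk); rewrite ltnn.
- by rewrite halfvS // belowS //; case: i j ij {ik jk} => [|i] [|j].
Qed.

Lemma flag_code_proper k u s i j : (2 < k <= d)%N -> odd #|u| ->
  (i < j <= d.+1)%N ->
  fverts (flag_code k u s i) \proper fverts (flag_code k u s j).
Proof.
move=> kd uo /andP[ij jd]; rewrite properEneq flag_codeS ?(ltnW ij) // andbT.
apply/eqP => eq_ij; have id := leq_trans (ltnW ij) jd.
have := frank_eq (valid_flag_code s kd uo id) (valid_flag_code s kd uo jd) eq_ij.
have /andP[_ {}kd] := kd.
by rewrite !frank_flag_code // => eq; rewrite eq ltnn in ij.
Qed.

End FlagParameters.

(** Applied to the kinds of the faces of a flag: above a half-cube there are only half-cubes, and
    the cut is the number of simplices. *)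
Lemma threshold (p : nat -> bool) n :
  (forall i j, (i <= j < n)%N -> p i -> p j) ->
  exists2 k, (k <= n)%N & forall j, (j < n)%N -> p j = (k <= j)%N.
Proof.
elim: n => [|n IHn] p_mono; first by exists 0%N.
have [|k kn pE] := IHn.
  by move=> i j /andP[ij jn]; apply: p_mono; rewrite ij ltnW.
have [pn|pn] := boolP (p n).
  exists k; first exact: leqW.
  by move=> j; rewrite ltnS leq_eqVlt => /predU1P[->|/pE//]; rewrite pn kn.
exists n.+1 => // j; rewrite ltnS => jn; rewrite [RHS]leqNgt ltnS jn /=.
by apply: contraNF pn; apply: p_mono; rewrite jn ltnSn.
Qed.

(** * Flags and their parameters *)

Section HalfCubeFlags.
Local Open Scope ring_scope.
Context {R : realType} {d : nat} (hd : (2 < d)%N).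
Import boot.fintype boot.finset.
Implicit Types (u : {set 'I_d}) (s : {perm 'I_d}).
Implicit Types (c : bool * {set 'I_d} * {set 'I_d}) (f : preflag R d).
Local Open Scope classical_set_scope.

Local Notation P := (half_cube R d).

Definition flag_of k u s : preflag R d := fun i => cface (flag_code k u s i.+1).

Lemma level_ord f (i : 'I_d) : level P f i.+1 = f i.
Proof. by rewrite /level valK. Qed.

Lemma level_top f : level P f d.+1 = P.
Proof. by rewrite /level insubN // ltnn. Qed.

Lemma level_flag_of k u s j : (k <= d)%N -> (j <= d.+1)%N ->
  level P (flag_of k u s) j = cface (flag_code k u s j).
Proof.
move=> kd; case: j => [_|j].
  rewrite /level /cface /flag_code /fverts /= /hullv.
  have -> : simplexv u (below s 0) = finset.set0.
    by apply/eqP; rewrite -cards_eq0 card_simplexv card_below.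
  apply/seteqP; split=> // x [n [p [w [Vp _ w1 _]]]].
  have := @oner_neq0 R; rewrite -w1 big1 ?eqxx // => i _.
  by have [A] := Vp i; rewrite /= inE.
rewrite ltnS leq_eqVlt => /predU1P[->|jd]; last first.
  by rewrite (level_ord _ (Ordinal jd)).
rewrite level_top -(@frank_full _ _ (flag_code k u s d.+1)) //.
by rewrite frank_flag_code.
Qed.

Lemma flag_of_is_flag k u s : (2 < k <= d)%N -> odd #|u| ->
  is_flag P (flag_of k u s).
Proof.
move=> kd uo; have /andP[_ kd'] := kd; split=> [i|i j ij].
  have id : (i.+1 <= d.+1)%N by rewrite ltnS ltnW.
  have v := valid_flag_code s kd uo id.
  have r := frank_flag_code u s kd' id.
  split; first by apply: proper_nonempty_cface => //; rewrite r /= ltn_ord.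
  by have := has_dim_cface (R := R) hd v; rewrite r; apply.
apply/cface_proper; do ?by apply: valid_flag_code => //; rewrite ltnS ltnW.
by apply: flag_code_proper; rewrite // ltnS ij ltnS ltnW.
Qed.

Lemma is_flag_code f : is_flag P f ->
  exists c : 'I_d -> bool * {set 'I_d} * {set 'I_d},
    (forall i, [/\ valid (c i), frank (c i) = i.+1 & f i = cface (c i)]) /\
    (forall i j : 'I_d, (i <= j)%N -> fverts (c i) \subset fverts (c j)).
Proof.
move=> [f_face f_lt].
have d_gt0 : (0 < d)%N by exact: leq_trans hd.
have ex_c (i : 'I_d) : exists c, [/\ valid c, frank c = i.+1 & f i = cface c].
  have [[f_is_face _ _] f_dim] := f_face i.
  have [c vc fE] := is_face_code d_gt0 f_is_face; exists c; split=> //.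
  by apply: (frank_has_dim (R := R) hd vc); rewrite -fE.
have [c cP] := boolp.choice ex_c; exists c; split=> // i j.
rewrite leq_eqVlt => /predU1P[/val_inj->//|/f_lt].
have [vi _ ->] := cP i; have [vj _ ->] := cP j.
by move=> /properW/(cfaceS vi vj).
Qed.

Lemma flag_ofP f : is_flag P f ->
  exists k u s, [/\ (2 < k <= d)%N, odd #|u| & f = flag_of k u s].
Proof.
move=> /is_flag_code[c [cP c_sub]].
pose e j : bool * {set 'I_d} * {set 'I_d} :=
  if insub j is Some i then c i else (false, finset.set0, finset.set0).
have eE (i : 'I_d) : e i = c i by rewrite /e valK.
have eP j : (j < d)%N -> valid (e j) /\ frank (e j) = j.+1.
  by move=> jd; rewrite (eE (Ordinal jd)); case: (cP (Ordinal jd)).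
have e_sub i j : (i <= j < d)%N -> fverts (e i) \subset fverts (e j).
  move=> /andP[ij jd]; have id := leq_ltn_trans ij jd.
  by rewrite (eE (Ordinal id)) (eE (Ordinal jd)); exact: c_sub.
have [|k kd kE] := @threshold (fun j => (e j).1.1) d.
  move=> i j /andP[ij jd]; have [vi _] := eP i (leq_ltn_trans ij jd).
  have := e_sub i j; rewrite ij jd => /(_ isT); move: vi.
  case: (e i) => [[[] u] M] // /andP[/= uo M3] + _.
  by case: (e j) => [[[] v] N] //; rewrite {1}/fverts halfv_nsub_simplexv.
(* [e j] has rank [j.+1], and half-cubes have rank at least 4, so [e 2] is a simplex. *)
have k3 : (2 < k)%N.
  rewrite ltnNge; apply/negP => k2; have /= := kE 2 hd; rewrite k2.
  have [] := eP 2 hd; case: (e 2) => [[h v] N] /andP[_] /= + + hE.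
  by rewrite hE /frank /= addn1 => N3 [N2]; rewrite N2 in N3.
have k1d : (k.-1 < d)%N by case: k k3 kd {kE}.
(* The last simplex contains all earlier faces and is contained in all half-cubes of the flag, so
   its base serves for every face. *)
have [u [M [uo cM eME]]] : exists u (M : {set 'I_d}),
    [/\ odd #|u|, #|M| = k & fverts (e k.-1) = simplexv u M].
  have := kE _ k1d; have := eP _ k1d; case: (e k.-1) => [[h u] M] /=.
  rewrite leqNgt prednK ?leqnn /= ?(ltnW (ltnW k3)) // => -[/andP[/= uo _]] cM hE.
  by exists u, M; split=> //; rewrite -?cM hE // /frank addn0.
pose G j := [set x | u :+: [set x]%SET \in fverts (e j)]%SET.
have GS i j : (i <= j < d)%N -> G i \subset G j.
  by move=> /e_sub/subsetP eS; apply/subsetP => x; rewrite !inE => /eS.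
have eG1 j : (j < k)%N -> fverts (e j) = simplexv u (G j) /\ #|G j| = j.+1.
  move=> jk; have jd := leq_trans jk kd.
  have : fverts (e j) \subset simplexv u M.
    by rewrite -eME e_sub // k1d andbT -ltnS prednK // ltnW // ltnW.
  case/sub_simplexv => K _ ejE.
  have GE : G j = K by apply/setP => x; rewrite inE ejE mem_simplexv1.
  rewrite GE -ejE; split=> //; rewrite -(card_simplexv u) -ejE.
  have [_ <-] := eP j jd; move: (kE j jd); rewrite leqNgt jk.
  by case: (e j) => [[[] v] L] //= _; rewrite /fverts /frank card_simplexv addn0.
have eG2 j : (k <= j < d)%N -> fverts (e j) = halfv u (G j) /\ #|G j| = j.
  move=> /andP[kj jd].
  have : simplexv u M \subset fverts (e j).
    by rewrite -eME e_sub // jd andbT (leq_trans (leq_pred k)).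
  have [_] := eP j jd; move: (kE j jd); rewrite kj.
  rewrite /G; case: (e j) => [[[] v] Z] //= _; rewrite /frank /fverts /= addn1 => -[cZ].
  case/simplexv_sub_halfv; first by rewrite cM (ltnW k3).
  move=> _ ->; suff -> : [set x | u :+: [set x]%SET \in halfv u Z]%SET = Z by [].
  by apply/setP => x; rewrite inE mem_halfv1.
(* A simplex [e j] has [j.+1] directions and a half-cube [e j] has [j], hence the shift by one. The
   set of size [k] is taken from the last simplex, and the full set completes the chain. *)
pose N j := if j is j'.+1 then
  (if (j <= k)%N then G j' else if (j < d)%N then G j else [set: 'I_d]%SET)
  else finset.set0.
have cN j : (j <= d)%N -> #|N j| = j.
  case: j => [|j] jd; first by rewrite cards0.
  rewrite /N; case: ifP => [/eG1[]//|/negbT]; rewrite -ltnNge => kj.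
  case: ifP => [j1d|/negbT]; first by have [|//] := eG2 j.+1; rewrite ltnW.
  by rewrite -leqNgt => dj; rewrite cardsT card_ord; apply/anti_leq; rewrite dj.
have subN j : (j < d)%N -> N j \subset N j.+1.
  case: j => [|j] jd; first exact: sub0set.
  rewrite /N; case: (leqP j.+2 k) => [jk|kj].
    by rewrite (ltnW jk) GS // leqnSn.
  case: (ltnP j.+2 d) => j2d; last exact: subsetT.
  case: (leqP j.+1 k) => _; last by rewrite jd GS // leqnSn.
  by rewrite GS // j2d andbT (leq_trans (leqnSn _)).
have [s sN] := below_full cN subN.
exists k, u, s; rewrite k3 kd; split=> //; apply/funext => i.
have [_ _ ->] := cP i; rewrite -eE /flag_of /cface; congr hullv.
have id := ltn_ord i; rewrite /flag_code; case: (leqP i.+1 k) => [ik|].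
  by rewrite -sN // /N ik (eG1 _ ik).1.
rewrite ltnS => ki; have [|-> cGi] := eG2 i; first by rewrite ki.
rewrite /fverts /= -sN ?(ltnW id) //; congr halfv.
case: (nat_of_ord i) ki id cGi (cN i (ltnW id)) => [|j] kj jd cGj cNj.
  by rewrite leqn0 in kj; rewrite (eqP kj) in k3.
rewrite /N; case: ifP => [jk|_]; last by rewrite jd.
(* Here [j.+1] = [k]: the first half-cube has the directions of the last simplex, by inclusion and
   equal size. *)
apply/eqP; rewrite eq_sym eqEcard GS ?leqnSn //=.
by rewrite cGj (eG1 _ jk).2.
Qed.

(** [k] is where the kind changes, the simplex of rank [k] has at least three vertices and so
    determines [u], and the chain is visible in rank [j] up to [k] and in rank [j.+1] beyond. *)
Lemma flag_of_inj k k' u u' s s' : (2 < k <= d)%N -> (2 < k' <= d)%N ->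
  odd #|u| -> odd #|u'| -> flag_of k u s = flag_of k' u' s' ->
  [/\ k = k', u = u' & s = s'].
Proof.
move=> kd kd' uo uo' eq_fl.
have eq_fv j : (j < d)%N ->
    fverts (flag_code k u s j.+1) = fverts (flag_code k' u' s' j.+1).
  move=> jd; have := congr1 (fun f => f (Ordinal jd)) eq_fl.
  rewrite /flag_of /= => /(cface_inj (R := R)); apply; apply: valid_flag_code => //; exact: leqW.
have no_lt l l' (v v' : {set 'I_d}) (t t' : {perm 'I_d}) :
    (2 < l <= d)%N -> (2 < l' <= d)%N -> odd #|v| ->
    (forall j, (j < d)%N ->
      fverts (flag_code l v t j.+1) = fverts (flag_code l' v' t' j.+1)) ->
    (l' <= l)%N.
  move=> /andP[l3 _] /andP[_ ld] vo eq_vv'; rewrite leqNgt; apply/negP => ll'.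
  have := eq_vv' l (leq_trans ll' ld).
  rewrite /flag_code ltnn ll' /fverts /= => eq_l.
  have := halfv_nsub_simplexv v' (below t' l.+1) vo (_ : 2 < #|below t l|)%N.
  by rewrite eq_l subxx card_below ?(leq_trans (ltnW ll')) // => /(_ l3).
have kk' : k = k'.
  apply/anti_leq; rewrite (no_lt _ _ _ _ _ _ kd kd' uo eq_fv) andbT.
  by apply: (no_lt k' k u' u s' s) => // j jd; rewrite eq_fv.
subst k'; have /andP[k3 kd0] := kd.
have uu' : u = u'.
  have k1d : (k.-1 < d)%N by case: k k3 kd0 {kd kd' eq_fl eq_fv}.
  have := eq_fv _ k1d; rewrite prednK ?(ltnW (ltnW k3)) //.
  rewrite /flag_code leqnn /fverts /= => eq_k.
  apply: (simplexv_sub_base (M := below s k) (N := below s' k)).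
    by rewrite card_below.
  by rewrite eq_k.
subst u'; split=> //; apply: below_inj => -[_|j jd].
  by apply/setP => x; rewrite !inE.
case: (leqP j.+1 k) => jk.
  by have := eq_fv _ jd; rewrite /flag_code jk => /simplexv_inj.
have [j1d|dj] := ltnP j.+1 d; last first.
  by have -> : j.+1 = d; [apply/anti_leq; rewrite jd | rewrite !below_d].
by have := eq_fv _ j1d; rewrite /flag_code leqNgt ltnS (ltnW jk) => /(halfv_inj uo).
Qed.

End HalfCubeFlags.

(** * The involutions and their effect on the number of simplices *)

Section HalfCubeSigma.
Local Open Scope ring_scope.
Context {R : realType} {d : nat} (hd : (2 < d)%N).
Import boot.fintype boot.finset.
Implicit Types (u : {set 'I_d}) (s : {perm 'I_d}).
Implicit Types (c : bool * {set 'I_d} * {set 'I_d}) (f : preflag R d).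
Local Open Scope classical_set_scope.

Local Notation P := (half_cube R d).

Lemma fverts_kind c1 c2 : valid c1 -> valid c2 -> fverts c1 = fverts c2 ->
  c1.1.1 = c2.1.1.
Proof.
case: c1 => [[[] u] M]; case: c2 => [[[] v] N] //= /andP[/= uo M3] /andP[/= vo N3];
  rewrite /fverts /= => eq_c.
  by have := halfv_nsub_simplexv v N uo M3; rewrite eq_c subxx.
by have := halfv_nsub_simplexv u M vo N3; rewrite eq_c subxx.
Qed.

Lemma fverts_proper c1 c2 : valid c1 -> valid c2 ->
  fverts c1 \subset fverts c2 -> (frank c1 < frank c2)%N ->
  fverts c1 \proper fverts c2.
Proof.
move=> v1 v2 sub r12; rewrite properEneq sub andbT; apply: contraL r12 => /eqP.
by move=> /(frank_eq v1 v2) ->; rewrite ltnn.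
Qed.

Lemma code_is_flag f (c : 'I_d -> bool * {set 'I_d} * {set 'I_d}) :
  (forall i, [/\ valid (c i), frank (c i) = i.+1 & f i = cface (c i)]) ->
  (forall i j : 'I_d, (i < j)%N -> fverts (c i) \subset fverts (c j)) ->
  is_flag P f.
Proof.
move=> cP c_sub; split=> [i|i j ij].
  have [vi ri ->] := cP i; split.
    by apply: proper_nonempty_cface => //; rewrite ri ltn_ord.
  by have := has_dim_cface (R := R) hd vi; rewrite ri; apply.
have [vi ri ->] := cP i; have [vj rj ->] := cP j.
apply/cface_proper => //; apply: fverts_proper => //; first exact: c_sub.
by rewrite ri rj ltnS.
Qed.

(** [other_face] speaks only of strict inclusions; between ranks [i.-1] and [i.+1] they force rank
    [i]. *)
Lemma other_face_code k u s i F : (2 < k <= d)%N -> odd #|u| -> (0 < i <= d)%N ->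
  other_face P (flag_of k u s) i F ->
  exists c, [/\ valid c, frank c = i, F = cface c,
    fverts (flag_code k u s i.-1) \subset fverts c &
    fverts c \subset fverts (flag_code k u s i.+1)].
Proof.
move=> kd uo /andP[i_gt0 id] [F_face _]; have /andP[_ kd'] := kd.
have i1d : (i.-1 <= d.+1)%N by rewrite (leq_trans (leq_pred _)) // leqW.
have [c vc ->] := is_face_code (leq_trans (isT : 0 < 3)%N hd) F_face.
rewrite !level_flag_of // => lo hi; exists c.
have vlo := valid_flag_code s kd uo i1d.
have vhi := valid_flag_code s kd uo (id : i.+1 <= d.+1)%N.
move/(cface_proper vlo vc): lo => lo; move/(cface_proper vc vhi): hi => hi.
split=> //; [|exact: proper_sub|exact: proper_sub].
have := frank_proper vlo vc lo; have := frank_proper vc vhi hi.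
rewrite !frank_flag_code // prednK // ltnS => ci ic.
by apply/anti_leq; rewrite ci ic.
Qed.

(** [diamond] is applied to the face of [f] and the two candidates. This frees [sigma] from the
    choice made by [xget]. *)
Lemma other_face_unique f i F F' : is_flag P f -> (0 < i <= d)%N ->
  other_face P f i F -> other_face P f i F' -> F = F'.
Proof.
move=> /(flag_ofP hd)[k [u [s [kd uo ->]]]] id oF oF'.
have /andP[_ kd'] := kd; have /andP[i_gt0 id'] := id.
have i1d : (i.-1 <= d.+1)%N by rewrite (leq_trans (leq_pred _)) // leqW.
have [c [vc rc FE lo hi]] := other_face_code kd uo id oF.
have [c' [vc' rc' FE' lo' hi']] := other_face_code kd uo id oF'.
have [_ + _ _] := oF; have [_ + _ _] := oF'; rewrite level_flag_of ?(leqW id') //.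
rewrite FE FE' => neq' neq.
have [eq_c|eq_c|eq_c] : [\/ fverts (flag_code k u s i) = fverts c,
    fverts (flag_code k u s i) = fverts c' | fverts c = fverts c'].
- apply: (@diamond _ (flag_code k u s i.-1) (flag_code k u s i.+1)) => //;
    rewrite ?frank_flag_code ?(leqW id') // ?rc ?rc' ?prednK //;
    do ?by apply: valid_flag_code => //; exact: leqW.
  + by split=> //; apply: flag_codeS => //; exact: leq_pred.
  + by split=> //; apply: flag_codeS.
- by case: neq; rewrite /cface eq_c.
- by case: neq'; rewrite /cface eq_c.
- by rewrite /cface eq_c.
Qed.

Lemma sigmaE f i F : is_flag P f -> (0 < i <= d)%N -> other_face P f i F ->
  sigma P i f = fun k => if k.+1 == i then F else f k.
Proof.
move=> fl id oF; apply/funext => k; rewrite /sigma; case: ifP => // _.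
case: xgetP => [G _ oG|/(_ F)//]; exact: other_face_unique oG oF.
Qed.

Lemma sigma_none f i : (forall F, ~ other_face P f i F) -> sigma P i f = f.
Proof.
move=> no_oF; apply/funext => k; rewrite /sigma; case: eqP => // ki; subst i.
by case: xgetP => [G _ /no_oF//|_]; rewrite level_ord.
Qed.

Lemma sigma_flag f i : is_flag P f -> (0 < i <= d)%N -> is_flag P (sigma P i f).
Proof.
move=> fl id; have [[F oF]|no_oF] := pselect (exists F, other_face P f i F); last first.
  by rewrite sigma_none // => F oF; apply: no_oF; exists F.
rewrite (sigmaE fl id oF); have [k [u [s [kd uo fE]]]] := flag_ofP hd fl.
subst f; have /andP[_ kd'] := kd.
have [c [vc rc -> lo hi]] := other_face_code kd uo id oF.
apply: (code_is_flag (c := fun j => if j.+1 == i then c else flag_code k u s j.+1)).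
  move=> j; have jd : (j.+1 <= d.+1)%N by rewrite ltnW // ltnS.
  case: eqP => [->//|_]; split=> //; first exact: valid_flag_code.
  by rewrite frank_flag_code.
move=> j l jl; case: eqP => [ji|_]; case: eqP => [li|_] //.
- by apply: subset_trans hi _; apply: flag_codeS; rewrite // -ji.
- by apply: subset_trans lo; apply: flag_codeS; rewrite // -li.
- by apply: flag_codeS => //; rewrite ltnW.
Qed.

(** [sigma (k.+1)] turns the first half-cube into a simplex, and [sigma k] turns the last simplex
    into a half-cube. The latter fails for [k] = 3, as a half-cube has rank at least 4. *)
Definition sigma_type k i : nat :=
  if i == k.+1 then k.+1 else if (i == k) && (3 < k)%N then k.-1 else k.

(* The number of simplices in the flag obtained from one with k simplices by
   applying sigma_1, ..., sigma_j. *)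
Definition zstep_type k j : nat :=
  if (3 < k)%N then (if (j < k)%N then k else k.-1) else maxn 3 j.

(** For [k] > 3 the number drops at step [k], and the only step that could raise [k.-1] again is
    step [k] itself, which has passed. For [k] = 3 it equals [j] after [j] >= 3 steps, so each
    following step raises it. *)
Lemma sigma_zstep_type k j : (2 < k)%N ->
  sigma_type (zstep_type k j) j.+1 = zstep_type k j.+1.
Proof.
rewrite /sigma_type /zstep_type; case: (ltnP 3 k) => [k4|k3] _; last first.
  case: (ltnP 2 j) => j3; last by case: j j3 => [|[|[]]].
  by rewrite (maxn_idPr j3) eqxx (maxn_idPr (leqW j3)).
case: (ltnP j k) => jk.
  rewrite eqSS (ltn_eqF jk) k4 andbT [in RHS]ltn_neqAle jk andbT.
  by case: (j.+1 == k).
have j1k : (j.+1 == k.-1.+1) = false by apply/eqP; lia.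
have j1k' : (j.+1 == k.-1) = false by apply/eqP; lia.
by rewrite j1k j1k' /= [(j.+1 < k)%N]ltnNge leqW.
Qed.

Lemma other_face_cface k u s i c : (2 < k <= d)%N -> odd #|u| -> (0 < i <= d)%N ->
  valid c -> frank c = i -> c.1.1 != (flag_code k u s i).1.1 ->
  fverts (flag_code k u s i.-1) \subset fverts c ->
  fverts c \subset fverts (flag_code k u s i.+1) ->
  other_face P (flag_of k u s) i (cface c).
Proof.
move=> kd uo /andP[i_gt0 id] vc rc kind lo hi; have /andP[_ kd'] := kd.
have i1d : (i.-1 <= d.+1)%N by rewrite (leq_trans (leq_pred _)) // leqW.
have vlo := valid_flag_code s kd uo i1d.
have vhi := valid_flag_code s kd uo (id : i.+1 <= d.+1)%N.
have vi := valid_flag_code s kd uo (leqW id).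
split; rewrite ?level_flag_of ?(leqW id) //; first exact: cface_is_face.
- by move=> /(cface_inj vc vi)/(fverts_kind vc vi)/eqP; rewrite (negPf kind).
- by apply/cface_proper => //; apply: fverts_proper; rewrite ?frank_flag_code ?rc ?prednK.
- by apply/cface_proper => //; apply: fverts_proper; rewrite ?frank_flag_code ?rc ?ltnSn.
Qed.

(** The new flag has some parameters by [flag_ofP], and its number [k'] of simplices is read off
    from kinds: all faces except the one of rank [i] keep theirs, so only [i] = [k] and [i] = [k.+1]
    can matter. *)
Lemma sigma_flag_of k u s i : (2 < k <= d)%N -> odd #|u| -> (0 < i <= d)%N ->
  exists u' s', odd #|u'| /\
    sigma P i (flag_of k u s) = flag_of (sigma_type k i) u' s'.
Proof.
move=> kd uo id; have fl := flag_of_is_flag (R := R) hd s kd uo.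
have [k' [u' [s' [kd' uo' sE]]]] := flag_ofP hd (sigma_flag fl id).
exists u', s'; split=> //; rewrite sE; congr (flag_of _ u' s').
have /andP[k3 kled] := kd; have /andP[k3' kled'] := kd'.
have kindE (j : 'I_d) c : valid c -> sigma P i (flag_of k u s) j = cface c ->
    (j < k')%N = ~~ c.1.1.
  move=> vc; rewrite sE /flag_of => /cface_inj.
  have vj : valid (flag_code k' u' s' j.+1) by apply: valid_flag_code; rewrite // ltnW // ltnS.
  move=> /(_ vj vc)/(fverts_kind vj vc) <-; rewrite /flag_code.
  by case: (leqP j.+1 k').
have stay j : (j < d)%N -> j.+1 != i -> (j < k')%N = (j < k)%N.
  move=> jd /negPf ji; rewrite (kindE (Ordinal jd) (flag_code k u s j.+1)).
  - by rewrite /flag_code; case: (leqP j.+1 k).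
  - by apply: valid_flag_code; rewrite // ltnW // ltnS.
  - by rewrite /sigma /= ji.
have k_gt0 : (0 < k)%N by exact: leq_trans k3.
have k1d : (k.-1 < d)%N by rewrite prednK.
have kk1 : (k.-1 < k)%N by rewrite prednK.
have upper m : (m <= d)%N -> m.+1 != i -> (k <= m)%N -> (k' <= m)%N.
  rewrite leq_eqVlt => /predU1P[->//|md] mi km.
  by rewrite leqNgt (stay m) // -leqNgt.
rewrite /sigma_type; have [ik1|ik1] := eqVneq i k.+1.
  have kd1 : (k < d)%N by rewrite -ik1; case/andP: id.
  (* The simplex with one more direction replaces the half-cube of rank [k.+1]. *)
  have oF : other_face P (flag_of k u s) i (cface (false, u, below s k.+1)).
    apply: other_face_cface => //; rewrite ?ik1 /=.
    - by rewrite /valid uo.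
    - by rewrite /frank /= addn0 card_below.
    - by rewrite /flag_code ltnn.
    - by rewrite /flag_code leqnn /fverts /= simplexvS belowS.
    - by rewrite /flag_code ltnNge leqW // /fverts /= simplexv_half.
  have := kindE (Ordinal kd1) (false, u, below s k.+1).
  rewrite (sigmaE fl id oF) /= ik1 eqxx /valid uo => /(_ isT erefl) kk'.
  by apply/anti_leq; rewrite kk' andbT upper // ik1 neq_ltn ltnSn orbT.
have [ik|ik] := eqVneq i k; last first.
  apply/anti_leq; rewrite upper // 1?eq_sym //=.
  by have := stay _ k1d; rewrite prednK // leqnn eq_sym => ->.
have [k4|k3e] := ltnP 3 k => /=; last first.
  have k3E : k = 3%N by apply/anti_leq; rewrite k3 k3e.
  by apply/anti_leq; rewrite upper // 1?eq_sym //= k3E.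
(* The half-cube over [k.-1] directions, at least three since [k] > 3, replaces the last simplex. *)
have oF : other_face P (flag_of k u s) i (cface (true, u, below s k.-1)).
  have cb : #|below s k.-1| = k.-1 by rewrite card_below // ltnW.
  apply: other_face_cface => //; rewrite ?ik /=.
  - by rewrite /valid uo /= cb -ltnS prednK.
  - by rewrite /frank /= addn1 cb prednK.
  - by rewrite /flag_code leqnn.
  - by rewrite /flag_code leq_pred /fverts /= simplexv_half.
  - by rewrite /flag_code ltnn /fverts /= halfvS // belowS // leq_pred.
have := kindE (Ordinal k1d) (true, u, below s k.-1).
rewrite (sigmaE fl id oF) /= prednK // ik eqxx /valid uo /= card_below ?(ltnW k1d) //.
have k4' : (2 < k.-1)%N by rewrite -ltnS prednK.
move=> /(_ k4' erefl)/negbT; rewrite -ltnNge => k'k.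
apply/anti_leq; rewrite -ltnS prednK // k'k /=.
have k2d : (k.-2 < d)%N by rewrite (leq_ltn_trans (leq_pred _)).
have k2E : k.-2.+1 = k.-1 by rewrite prednK // -ltnS prednK // ltnW.
have := stay _ k2d; rewrite k2E leq_pred ik => -> //.
by rewrite neq_ltn kk1.
Qed.

Lemma zstep_flag_of k u s : (2 < k <= d)%N -> odd #|u| ->
  exists u' s', odd #|u'| /\
    zstep P (flag_of k u s) = flag_of (if (3 < k)%N then k.-1 else d) u' s'.
Proof.
move=> kd uo; have /andP[k3 kled] := kd.
have steps j : (j <= d)%N -> exists u' s', odd #|u'| /\
    foldl (fun g i => sigma P i g) (flag_of k u s) (iota 1 j) = flag_of (zstep_type k j) u' s'.
  elim: j => [|j IHj] jd.
    exists u, s; split=> //=; congr (flag_of _ u s); rewrite /zstep_type.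
    case: (ltnP 3 k) => [k4|k_le3]; first by rewrite (ltn_trans _ k4).
    by apply/anti_leq; rewrite k_le3 k3.
  have [u' [s' [uo' fE]]] := IHj (ltnW jd).
  rewrite -[in iota 1 _](addn1 j) iotaD foldl_cat fE /= add1n.
  have td : (2 < zstep_type k j <= d)%N.
    rewrite /zstep_type; case: (ltnP 3 k) => [k4|_].
      case: (ltnP j k) => // _; rewrite -ltnS prednK ?k4 ?(leq_trans (leq_pred _)) //.
      exact: leq_trans k3.
    by rewrite leq_max /= geq_max hd ltnW.
  have [//|u2 [s2 [uo2 ->]]] := sigma_flag_of s' td uo' (i := j.+1).
  exists u2, s2; split=> //; congr (flag_of _ u2 s2).
  exact: sigma_zstep_type.
have [u' [s' [uo' zE]]] := steps _ (leqnn d); exists u', s'; split=> //.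
rewrite /zstep zE /zstep_type; case: ltnP => _; first by rewrite ltnNge kled.
by rewrite (maxn_idPr hd).
Qed.

Lemma iter_zstep_top k u s : (2 < k <= d)%N -> odd #|u| ->
  exists n u' s', odd #|u'| /\ iter n (zstep P) (flag_of k u s) = flag_of d u' s'.
Proof.
elim: k u s => // k IHk u s kd uo; have [u1 [s1 [uo1 zE]]] := zstep_flag_of s kd uo.
move: zE; case: ltnP => [k3 zE|_ zE]; last by exists 1%N, u1, s1.
have [|n [u2 [s2 [uo2 nE]]]] := IHk u1 s1 _ uo1.
  by rewrite -ltnS k3 ltnW //; case/andP: kd.
by exists n.+1, u2, s2; split=> //; rewrite iterSr zE.
Qed.

End HalfCubeSigma.

(** * Isometries and their action on faces and flags *)

Section Isometries.
Local Open Scope ring_scope.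
Context {R : realType} {d : nat}.
Implicit Types (x y : 'rV[R]_d) (phi psi : 'rV[R]_d -> 'rV[R]_d).
Implicit Types (P F : set 'rV[R]_d) (f : preflag R d).
Local Open Scope classical_set_scope.

Lemma dot_isometry phi x y : (forall x y, edist (phi x) (phi y) = edist x y) ->
  dot (phi x - phi y) (phi x - phi y) = dot (x - y) (x - y).
Proof.
move=> phiE; rewrite -[LHS]sqr_sqrtr ?dot_ge0 // -[RHS]sqr_sqrtr ?dot_ge0 //.
by congr (_ ^+ 2); exact: phiE.
Qed.

(** Normalised to fix 0, the map preserves [dot] by polarisation. Its values on the unit vectors are
    the rows of [A], and [psi x *m A^T] recovers [x]; this gives both orthogonality and
    linearity. *)
Lemma isometry_affine phi : (forall x y, edist (phi x) (phi y) = edist x y) ->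
  exists A : 'M[R]_d, A *m A^T = 1%:M /\ forall x, phi x = phi 0 + x *m A.
Proof.
move=> phiE; pose psi x := phi x - phi 0.
have dotBB x y : dot (x - y) (x - y) = dot x x + dot y y - dot x y *+ 2.
  rewrite dotBr !(dotC (x - y)) !dotBr (dotC y x) mulr2n; ring.
have psi_dist x y : dot (psi x - psi y) (psi x - psi y) = dot (x - y) (x - y).
  by rewrite -(dot_isometry x y phiE) /psi opprB addrA subrK.
have psi0 : psi 0 = 0 by rewrite /psi subrr.
have psi_norm x : dot (psi x) (psi x) = dot x x.
  by have := psi_dist x 0; rewrite psi0 !subr0.
have psi_dot x y : dot (psi x) (psi y) = dot x y.
  have := psi_dist x y; rewrite dotBB !psi_norm [RHS]dotBB => /addrI/oppr_inj.
  by rewrite !mulr2n => ?; lra.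
pose A := \matrix_i psi (delta_mx 0 i).
have psiAT x : psi x *m A^T = x.
  apply/rowP => i; have -> : (psi x *m A^T) 0 i = dot (psi x) (psi (delta_mx 0 i)).
    by rewrite mxE; apply: eq_bigr => j _; rewrite !mxE.
  rewrite psi_dot /dot (bigD1 i) //= big1 ?addr0 => [|j ji].
    by rewrite mxE !eqxx mulr1.
  by rewrite mxE eqxx (negPf ji) mulr0.
have AAT : A *m A^T = 1%:M.
  by apply/row_matrixP => i; rewrite row_mul rowK psiAT row1.
exists A; split=> // x; rewrite -[in RHS](psiAT x) -mulmxA (mulmx1C AAT) mulmx1.
by rewrite /psi addrC subrK.
Qed.

Lemma symmetry_face P F phi : symmetry P phi -> is_face P F ->
  is_face P (phi @` F).
Proof.
move=> [/isometry_affine[A [AAT phiE]] phiP] [w [b [Pb ->]]].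
have dot_phi x : dot (w *m A) (phi x) = dot (w *m A) (phi 0) + dot w x.
  rewrite phiE dotDr; congr (_ + _).
  by rewrite !dotE trmx_mul mulmxA -[w *m A *m _]mulmxA AAT mulmx1.
exists (w *m A), (dot (w *m A) (phi 0) + b); split.
  by move=> y; rewrite -{1}phiP => -[x Px <-]; rewrite dot_phi lerD2l Pb.
apply/seteqP; split=> [_ [x [Px /= wx] <-]|y [Py /=]].
  by split; [rewrite -phiP; exists x | rewrite /= dot_phi wx].
move: Py; rewrite -{1}phiP => -[x Px <-]; rewrite dot_phi => /addrI wx.
by exists x.
Qed.

Lemma symmetry_inverse P phi : symmetry P phi ->
  exists psi, [/\ symmetry P psi, cancel phi psi & cancel psi phi].
Proof.
move=> [phi_iso phiP]; have [A [AAT phiE]] := isometry_affine phi_iso.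
pose psi y := (y - phi 0) *m A^T.
have phiK : cancel phi psi.
  by move=> x; rewrite /psi phiE [phi 0 + _]addrC addrK -mulmxA AAT mulmx1.
have psiK : cancel psi phi.
  by move=> y; rewrite phiE /psi -mulmxA (mulmx1C AAT) mulmx1 addrC subrK.
exists psi; split=> //; split.
  by move=> x y; rewrite -phi_iso !psiK.
apply/seteqP; split=> [_ [y Py <-]|x Px].
  by move: Py; rewrite -{1}phiP => -[x Px <-]; rewrite phiK.
by exists (phi x); rewrite ?phiK // -phiP; exists x.
Qed.

Lemma symmetry_comp P phi psi : symmetry P phi -> symmetry P psi ->
  symmetry P (psi \o phi).
Proof.
move=> [phi_iso phiP] [psi_iso psiP]; split; first by move=> x y; rewrite psi_iso.
by rewrite -image_comp phiP.
Qed.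

Lemma symmetry_id P : symmetry P id.
Proof. by split=> //; rewrite image_id. Qed.

Lemma affinely_independent_isometry n (p : 'I_n.+1 -> 'rV[R]_d) phi :
  (forall x y, edist (phi x) (phi y) = edist x y) ->
  affinely_independent p -> affinely_independent (phi \o p).
Proof.
move=> /isometry_affine[A [AAT phiE]]; rewrite /affinely_independent.
set M := \matrix_i _ => M_free.
have -> : \matrix_(i < n) ((phi \o p) (lift ord0 i) - (phi \o p) ord0) = M *m A.
  apply/row_matrixP => i; rewrite row_mul !rowK /= phiE [in X in _ - X]phiE.
  by rewrite addrAC opprD addrA subrr sub0r mulmxBl addrC.
have A_free : row_free A by rewrite row_free_unit; have [] := mulmx1_unit AAT.
by rewrite /row_free mxrankMfree.
Qed.

Lemma has_dim_symmetry P F n phi : symmetry P phi -> has_dim F n ->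
  has_dim (phi @` F) n.
Proof.
move=> sym [[p [p_ind Fp]] n_max]; have [psi [[psi_iso _] phiK _]] := symmetry_inverse sym.
split.
  exists (phi \o p); split; first by apply: affinely_independent_isometry p_ind; case: sym.
  by move=> k; exists (p k).
move=> m q q_ind Fq; apply: (n_max m (psi \o q)).
  exact: affinely_independent_isometry q_ind.
by move=> k; have [x Fx xq] := Fq k; rewrite /= -xq phiK.
Qed.

Lemma image_proper phi psi F F' : cancel phi psi ->
  F `<` F' -> phi @` F `<` phi @` F'.
Proof.
move=> phiK [sub nsub]; split; first exact: image_subset.
move=> sub'; apply: nsub => x F'x.
have [|y Fy /(congr1 psi)] := sub' (phi x); first by exists x.
by rewrite !phiK => <-.
Qed.

Lemma image_can phi psi F : cancel phi psi -> psi @` (phi @` F) = F.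
Proof.
move=> phiK; rewrite image_comp -[RHS]image_id; congr (_ @` _).
exact/funext.
Qed.

Definition act phi f : preflag R d := fun k => phi @` f k.

Lemma act_can phi psi : cancel phi psi -> cancel (act phi) (act psi).
Proof. by move=> phiK f; apply/funext => k; exact: image_can. Qed.

Lemma act_comp phi psi f : act psi (act phi f) = act (psi \o phi) f.
Proof. by apply/funext => k; rewrite /act image_comp. Qed.

Lemma act_id f : act id f = f.
Proof. by apply/funext => k; rewrite /act image_id. Qed.

Lemma level_act P phi f i : symmetry P phi ->
  level P (act phi f) i = phi @` level P f i.
Proof.
move=> [_ phiP]; case: i => [|i] /=; first by rewrite image_set0.
by case: insub.
Qed.

Lemma act_is_flag P phi f : symmetry P phi -> is_flag P f -> is_flag P (act phi f).
Proof.
move=> sym [f_face f_lt]; have [psi [_ phiK _]] := symmetry_inverse sym.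
split=> [k|k l kl]; last exact: image_proper phiK (f_lt _ _ kl).
have [[fk_face [x fx] fkP] fk_dim] := f_face k.
split; last exact: has_dim_symmetry sym fk_dim.
split; [exact: symmetry_face | by exists (phi x); exists x |].
have [_ phiP] := sym.
by rewrite -{1}phiP => /(congr1 (image^~ psi)); rewrite /= !(image_can _ phiK).
Qed.

Lemma other_face_act P phi f i F : symmetry P phi ->
  other_face P f i F -> other_face P (act phi f) i (phi @` F).
Proof.
move=> sym [F_face neq lo hi]; have [psi [_ phiK _]] := symmetry_inverse sym.
split; rewrite ?(level_act _ _ sym).
- exact: symmetry_face.
- by move=> /(congr1 (image^~ psi)); rewrite !(image_can _ phiK).
- exact: image_proper phiK lo.
- exact: image_proper phiK hi.
Qed.

Lemma face_array_act P phi f (x : nat -> nat -> set _) : symmetry P phi ->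
  face_array P f x -> face_array P (act phi f) (fun i j => phi @` x i j).
Proof.
move=> sym [x_face x1 x_lt x_lt' x_neq]; have [psi [_ phiK _]] := symmetry_inverse sym.
split.
- move=> i j ij; have [? ?] := x_face i j ij.
  by split; [exact: symmetry_face | exact: has_dim_symmetry sym _].
- by move=> k; rewrite x1.
- by move=> i j ij ij'; apply: image_proper phiK _; exact: x_lt.
- by move=> i j ij ij'; apply: image_proper phiK _; exact: x_lt'.
- move=> i j ij ij' /(congr1 (image^~ psi)); rewrite !(image_can _ phiK).
  exact: x_neq.
Qed.

Lemma image_convex_hull phi (V : set 'rV[R]_d) :
  (forall x y, edist (phi x) (phi y) = edist x y) ->
  phi @` convex_hull V = convex_hull (phi @` V).
Proof.
move=> /isometry_affine[A [_ phiE]].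
have phi_conv n (p : 'I_n -> 'rV[R]_d) (w : 'I_n -> R) : \sum_k w k = 1 ->
    phi (\sum_k w k *: p k) = \sum_k w k *: phi (p k).
  move=> w1; under [RHS]eq_bigr do rewrite phiE scalerDr scalemxAl.
  by rewrite big_split /= -scaler_suml w1 scale1r -mulmx_suml phiE.
apply/seteqP; split=> [_ [x [n [p [w [Vp w0 w1 ->]]]] <-]|].
  exists n, (phi \o p), w; split=> // [k|]; first by exists (p k).
  exact: phi_conv.
move=> y [n [q [w [Vq w0 w1 ->]]]].
have /boolp.choice[p pP] : forall k, exists x, V x /\ phi x = q k.
  by move=> k; have [x Vx <-] := Vq k; exists x.
exists (\sum_k w k *: p k); first by exists n, p, w; split=> // k; have [] := pP k.
by rewrite phi_conv //; apply: eq_bigr => k _; have [_ ->] := pP k.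
Qed.

Lemma image_hullv phi (m : {set 'I_d} -> {set 'I_d}) (W : {set {set 'I_d}}) :
  (forall x y, edist (phi x) (phi y) = edist x y) ->
  (forall A, A \in W -> phi (hvec A) = hvec (m A)) ->
  phi @` hullv W = hullv (m @: W).
Proof.
move=> phi_iso phi_m; rewrite /hullv image_convex_hull //; congr convex_hull.
apply/seteqP; split=> [_ [_ [A /= AW <-] <-]|_ [B /= /imsetP[A AW ->] <-]].
  by exists (m A); [exact: imset_f | rewrite phi_m].
by exists (hvec A); [exists A | rewrite phi_m].
Qed.

End Isometries.

(** * Equivariance of zigzags and reverses, and invariance of [k] *)

Section Equivariance.
Local Open Scope ring_scope.
Context {R : realType} {d : nat} (hd : (2 < d)%N).
Import boot.fintype boot.finset.
Implicit Types (u v A B : {set 'I_d}) (s t : {perm 'I_d}).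
Implicit Types (c : bool * {set 'I_d} * {set 'I_d}) (f g : preflag R d).
Implicit Types (phi psi : 'rV[R]_d -> 'rV[R]_d).
Local Open Scope classical_set_scope.

Local Notation P := (half_cube R d).

(** The other face is unique, so the choice is carried along. If [f] has no other face, neither has
    its image, by the inverse symmetry, and both sides keep the old face. *)
Lemma sigma_act phi f i : symmetry P phi -> is_flag P f -> (0 < i <= d)%N ->
  sigma P i (act phi f) = act phi (sigma P i f).
Proof.
move=> sym fl id; have [psi [psi_sym phiK psiK]] := symmetry_inverse sym.
have [[F oF]|no_oF] := pselect (exists F, other_face P f i F).
  rewrite (sigmaE hd (act_is_flag sym fl) id (other_face_act sym oF)).
  by rewrite (sigmaE hd fl id oF) /act; apply/funext => k; case: ifP.
rewrite (sigma_none (f := f)) => [|F oF]; last by apply: no_oF; exists F.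
apply: sigma_none => F /(other_face_act psi_sym); rewrite (act_can phiK) => oF.
by apply: no_oF; exists (psi @` F).
Qed.

Lemma zstep_act phi f : symmetry P phi -> is_flag P f ->
  zstep P (act phi f) = act phi (zstep P f) /\ is_flag P (zstep P f).
Proof.
move=> sym; have : all (fun i => 0 < i <= d)%N (iota 1 d).
  by apply/allP => i; rewrite mem_iota add1n ltnS.
rewrite /zstep; elim: (iota 1 d) f => [|i l IHl] f //= /andP[id ld] fl.
by rewrite sigma_act //; apply: IHl => //; exact: sigma_flag.
Qed.

(** Induction on [j], then on [i]: the new entry and [x i.+1 j.+1], from which it differs, both lie
    between [x i j.+2] and [x i.+2 j.+1], so [diamond] leaves one possibility. *)
Lemma face_array_unique f x x' : face_array P f x -> face_array P f x' ->
  forall i j, array_index (d := d) i j -> x i j = x' i j.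
Proof.
move=> [x_face x1 x_lt x_lt' x_neq] [x'_face x'1 x'_lt x'_lt' x'_neq] i j.
have codeE (y : nat -> nat -> set 'rV[R]_d) :
    (forall i j, array_index (d := d) i j -> is_face P (y i j) /\ has_dim (y i j) i.-1) ->
    forall i j, array_index (d := d) i j ->
    exists c, [/\ valid c, frank c = i & y i j = cface c].
  move=> y_face k l kl; have [y_is_face y_dim] := y_face k l kl.
  have [c vc yE] := is_face_code (ltn_trans (isT : 0 < 2)%N hd) y_is_face.
  exists c; split=> //; rewrite yE in y_dim.
  by rewrite (frank_has_dim hd vc y_dim) prednK //; case/andP: kl.
elim: j i => [|j IHj] i; first by rewrite /array_index andbF.
case: j IHj => [|j] IHj.
  move=> /and3P[i_gt0 _]; rewrite addn1 ltnS => id.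
  have [k ->] : exists k : 'I_d, i = k.+1.
    by case: i i_gt0 id => // i _ id; exists (Ordinal id).
  by rewrite x1 x'1.
elim: i => // i IHi ij.
have ij1 : array_index (d := d) i.+1 j.+1.
  by move: ij; rewrite /array_index /= addnS => /ltnW.
have ij2 : array_index (d := d) i.+2 j.+1 by rewrite /array_index /= addSnnS; exact: ij.
have [a [va ra aE]] : exists a, [/\ valid a, frank a = i &
    forall c, valid c -> cface c = x i.+1 j.+1 \/ cface c = x i.+1 j.+2 \/
      cface c = x' i.+1 j.+2 -> fverts a \subset fverts c].
  case: i IHi ij ij1 ij2 => [|i] IHi ij ij1 ij2.
    (* In the lowest row the empty face plays the part of the lower entry; [x0] supplies an odd base
       for its code. *)
    pose x0 : 'I_d := Ordinal (ltn_trans (isT : 0 < 2)%N hd).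
    exists (false, [set x0]%SET, finset.set0).
    rewrite /valid /frank /fverts /simplexv /= cards1 cards0 imset0.
    by split=> // c _ _; exact: sub0set.
  have ij3 : array_index (d := d) i.+1 j.+2.
    by move: ij; rewrite /array_index /= addSn => /ltnW.
  have [a [va ra aE]] := codeE x x_face _ _ ij3; exists a; split=> // c vc cE.
  suff /properW : cface a `<` (cface c : set 'rV[R]_d) by move/(cfaceS va vc).
  rewrite -aE.
  case: cE => [->|[->|->]]; [exact: x_lt' | exact: x_lt |].
  by rewrite IHi //; exact: x'_lt.
have [b [vb rb bE]] := codeE x x_face _ _ ij2.
have [c [vc rc cE]] := codeE x x_face _ _ ij1.
have [c1 [vc1 rc1 c1E]] := codeE x x_face _ _ ij.
have [c2 [vc2 rc2 c2E]] := codeE x' x'_face _ _ ij.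
have xx'1 : x i.+1 j.+1 = x' i.+1 j.+1 by exact: IHj.
have xx'2 : x i.+2 j.+1 = x' i.+2 j.+1 by exact: IHj.
have [eq_c|eq_c|eq_c] : [\/ fverts c = fverts c1, fverts c = fverts c2
    | fverts c1 = fverts c2].
- apply: (@diamond _ a b) => //; rewrite ?ra ?rb ?rc ?rc1 ?rc2 //.
    by split; apply: aE => //; [left | right; left | right; right].
  have below_b (c' : bool * {set 'I_d} * {set 'I_d}) : valid c' ->
      cface c' `<` (cface b : set 'rV[R]_d) -> fverts c' \subset fverts b.
    by move=> vc' /properW/(cfaceS vc' vb).
  split; apply: below_b => //.
  + by rewrite -cE -bE; exact: x_lt.
  + by rewrite -c1E -bE; exact: x_lt'.
  + by rewrite -c2E -bE xx'2; exact: x'_lt'.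
- by case: (x_neq _ _ ij ij1); rewrite cE c1E /cface eq_c.
- by case: (x'_neq _ _ ij ij1); rewrite /= -xx'1 cE c2E /cface eq_c.
- by rewrite c1E c2E /cface eq_c.
Qed.

(** A flag has at most one candidate reverse, and symmetries carry candidates to candidates in both
    directions. Without a candidate, the default [f] is carried along as well. *)
Lemma flag_reverse_act phi f : symmetry P phi ->
  flag_reverse P (act phi f) = act phi (flag_reverse P f).
Proof.
move=> sym; have [psi [psi_sym phiK psiK]] := symmetry_inverse sym.
pose rev_of f := [set g : preflag R d | exists2 x, face_array P f x &
                   forall k : 'I_d, g k = x k.+1 (d - k)%N].
have rev_act theta h g : symmetry P theta -> rev_of h g ->
    rev_of (act theta h) (act theta g).
  move=> theta_sym [x hx gE]; exists (fun i j => theta @` x i j).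
    exact: face_array_act.
  by move=> k; rewrite /act gE.
have rev_unique h g g' : rev_of h g -> rev_of h g' -> g = g'.
  move=> [x hx gE] [x' hx' g'E]; apply/funext => k; rewrite gE g'E.
  apply: face_array_unique hx hx' _ _ _.
  by rewrite /array_index /= subn_gt0 ltn_ord addSn subnKC ?(ltnW (ltn_ord k)) /=.
rewrite /flag_reverse -/(rev_of f) -/(rev_of (act phi f)).
case: xgetP => [g _ og|no_og].
  case: xgetP => [h _ oh|no_oh]; first exact: rev_unique og (rev_act _ _ _ sym oh).
  by case: (no_oh (act psi g)); rewrite -(act_can phiK f); exact: rev_act.
case: xgetP => [h _ oh|//]; case: (no_og (act phi h)); exact: rev_act.
Qed.

Lemma hvec_face A i : ~~ odd #|A| ->
  let c := (false, A :+: [set i]%SET, [set i]%SET) in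
  valid c /\ cface c = [set hvec A] :> set 'rV[R]_d.
Proof.
move=> Ae /=; split; first by rewrite /valid /= odd_symd (negPf Ae) cards1.
rewrite /cface /fverts /simplexv /= imset_set1 symdK /hullv.
apply/seteqP; split=> [x [n [p [w [pA _ w1 ->]]]]|_ ->]; last first.
  by apply: convex_hull_sub; exists A => //=; rewrite inE.
rewrite /= -[hvec A]scale1r -w1 scaler_suml; apply: eq_bigr => k _.
by congr (_ *: _); have [B /=] := pA k; rewrite inE => /eqP-> <-.
Qed.

(** Vertices are the faces of dimension 0, and symmetries preserve faces and dimension. *)
Lemma symmetry_hvec phi A : symmetry P phi -> ~~ odd #|A| ->
  exists2 B : {set 'I_d}, ~~ odd #|B| & phi (hvec A) = hvec B.
Proof.
move=> sym Ae; pose x0 : 'I_d := Ordinal (ltn_trans (isT : 0 < 2)%N hd).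
have [vc cE] := hvec_face x0 Ae.
have := symmetry_face sym (cface_is_face vc); rewrite cE image_set1.
move=> /(is_face_code (ltn_trans (isT : 0 < 2)%N hd))[c' vc' c'E].
have c_gt0 : (0 < frank (false, A :+: [set x0], [set x0])%SET)%N.
  by rewrite /frank /= cards1.
have := has_dim_symmetry sym (has_dim_cface (R := R) hd vc c_gt0).
rewrite cE image_set1 c'E => /(frank_has_dim hd vc') rc'.
have [|B Bc'] := frank_gt0 vc'; first by rewrite rc'.
exists B; first exact: even_fverts Bc'.
have : (cface c' : set 'rV[R]_d) (hvec B) := hullv_hvec Bc'.
by rewrite -c'E => <-.
Qed.

Lemma act_flag_of_lt phi k l u v s t : symmetry P phi ->
  (2 < k <= d)%N -> (2 < l <= d)%N -> odd #|u| -> odd #|v| ->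
  act phi (flag_of k u s) = flag_of l v t -> (k < l)%N -> (l < 5)%N.
Proof.
move=> sym kd ld uo vo eq_f kl; rewrite ltnNge; apply/negP => l5.
have /andP[l3 lled] := ld; have l_gt0 : (0 < l)%N by exact: leq_trans l3.
have l1d : (l.-1 < d)%N by rewrite prednK.
have /card_gt0P[a aX] : (0 < #|below s 4|)%N.
  by rewrite card_below // (leq_trans (ltnW l5)).
(* The base [u] is odd and not a vertex, so the pair starts at its neighbour in direction [a]; [A]
   and [B] differ in the four elements of [below s 4]. *)
pose A := u :+: [set a]%SET; pose B := A :+: below s 4.
have cX : #|below s 4| = 4%N by rewrite card_below // (leq_trans (ltnW l5)).
have sX : below s 4 \subset below s l.-1 by rewrite belowS // -ltnS prednK.
have kl1 : (l <= k)%N = false by rewrite leqNgt kl.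
have Af : A \in fverts (flag_code k u s l).
  by rewrite /flag_code kl1 /fverts /= mem_halfv1 // (subsetP sX).
have Ae : ~~ odd #|A| by rewrite odd_symd uo cards1.
have Be : ~~ odd #|B| by rewrite odd_symd (negPf Ae) cX.
have Bf : B \in fverts (flag_code k u s l).
  rewrite /flag_code kl1 /fverts /= inE Be; apply: subset_trans sX.
  apply/subsetP => x; rewrite !in_symd inE.
  by have [->|_] := eqVneq x a; rewrite ?aX // addbF addbAC addbb.
have [A' A'e AE] := symmetry_hvec sym Ae.
have [B' B'e BE] := symmetry_hvec sym Be.
have vl : valid (flag_code l v t l) by apply: valid_flag_code => //; exact: leqW.
have in_l (C C' : {set 'I_d}) : C \in fverts (flag_code k u s l) -> ~~ odd #|C'| ->
    phi (hvec C) = hvec C' -> C' \in simplexv v (below t l).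
  move=> Cf C'e CE; have := congr1 (fun f => f (Ordinal l1d)) eq_f.
  rewrite /act /flag_of /= prednK // => eq_l.
  have : (cface (flag_code l v t l) : set 'rV[R]_d) (hvec C').
    by rewrite -eq_l -CE; exists (hvec C) => //; exact: hullv_hvec.
  by move=> /(cface_hvec vl C'e); rewrite /flag_code leqnn.
have := dot_isometry (hvec A) (hvec B) sym.1.
rewrite AE BE !hvec_dist => /eqP; rewrite eqr_nat /B symdKl cX.
have /imsetP[i _ ->] := in_l _ _ Af A'e AE.
have /imsetP[j _ ->] := in_l _ _ Bf B'e BE.
have : (#|v :+: [set i]%SET :+: (v :+: [set j]%SET)| <= #|[set i; j]%SET|)%N.
  apply/subset_leq_card/subsetP => x; rewrite !in_symd !inE.
  by case: (x \in v); case: (x == i); case: (x == j).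
by rewrite cards2 => le2 /eqP E4; move: le2; rewrite E4; case: eqP.
Qed.

Lemma act_flag_of_type phi k l u v s t : (4 < d)%N -> symmetry P phi ->
  (2 < k <= d)%N -> (2 < l <= d)%N -> odd #|u| -> odd #|v| ->
  act phi (flag_of k u s) = flag_of l v t -> k = l.
Proof.
move=> d5.
wlog kl : phi k l u v s t / (k < l)%N.
  move=> wlt sym kd ld uo vo eq_f; have [kl|lk|//] := ltngtP k l.
    exact: (wlt phi k l u v s t).
  have [psi [psi_sym phiK _]] := symmetry_inverse sym.
  apply/esym/(wlt psi l k v u t s) => //.
  by rewrite -eq_f (act_can phiK).
move=> sym kd ld uo vo eq_f.
have l4 := act_flag_of_lt sym kd ld uo vo eq_f kl; have /andP[k3 _] := kd.
have lE : l = 4%N by apply/anti_leq; rewrite -ltnS l4 (leq_ltn_trans k3 kl).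
have kE : k = 3%N by apply/anti_leq; rewrite k3 andbT -ltnS -lE.
subst k l; have d5' : (0 < 5 <= d)%N by rewrite d5.
(* [sigma 5] raises 4 to 5 and keeps 3, which turns the pair 3, 4 into the pair 3, 5 excluded by
   [act_flag_of_lt]. *)
have [u' [s' [uo' uE]]] := sigma_flag_of (R := R) hd s kd uo d5'.
have [v' [t' [vo' vE]]] := sigma_flag_of (R := R) hd t ld vo d5'.
have eq_f' : act phi (flag_of 3 u' s') = flag_of 5 v' t'.
  by rewrite -[flag_of 3 _ _]uE -[RHS]vE -eq_f sigma_act //; exact: flag_of_is_flag.
by have := act_flag_of_lt sym kd (d5 : 2 < 5 <= d)%N uo' vo' eq_f' isT.
Qed.

End Equivariance.

(** * Cardinality of injective images and of the family of odd sets *)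

Lemma card_image_finset (T : finType) (U : Type) (X : {set T}) (f : T -> U) (x0 : T) :
  {in X &, injective f} -> (f @` [set` X] #= `I_#|X|)%card.
Proof.
move=> f_inj; have -> : (f @` [set` X] =
    (fun i => f (nth x0 (enum X) i)) @` `I_#|X|)%classic.
  apply/seteqP; split=> [_ [x /= xX <-]|_ [i /= ilt <-]].
    by exists (index x (enum X)); rewrite /= ?nth_index ?mem_enum // cardE index_mem mem_enum.
  by exists (nth x0 (enum X) i) => //=; rewrite -mem_enum mem_nth // -cardE.
apply: inj_card_eq => i j; rewrite !inE /= => ilt jlt.
have inX k : (k < #|X|)%N -> nth x0 (enum X) k \in X.
  by move=> klt; rewrite -mem_enum mem_nth // -cardE.
move=> /(f_inj _ _ (inX _ ilt) (inX _ jlt))/eqP.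
by rewrite nth_uniq ?enum_uniq -?cardE // => /eqP.
Qed.

(** Toggling [x0] exchanges odd and even sets. *)
Lemma card_odd_sets (T : finType) (x0 : T) :
  #|[set A : {set T} | odd #|A|]%SET| = (2 ^ #|T|.-1)%N.
Proof.
set X := [set A | _]%SET; pose m (A : {set T}) := A :+: [set x0]%SET.
have m_inj : injective m by move=> A B /(congr1 m); rewrite /m !symdK.
have XC : m @: X = (~: X)%SET.
  apply/setP => A; rewrite !inE; apply/imsetP/idP => [[B + ->]|Ae].
    by rewrite inE /m odd_symd cards1 addbT negbK.
  by exists (m A); rewrite /m ?symdK // inE odd_symd cards1 addbT.
have := cardsC X; rewrite -XC card_imset // -cardsT -powersetT card_powerset cardsT.
have T_gt0 : (0 < #|T|)%N by apply/card_gt0P; exists x0.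
rewrite -[in X in _ = X](prednK T_gt0) expnS mul2n -addnn => XX.
by apply: double_inj; rewrite -!addnn.
Qed.

(** * Symmetries induced by the cube *)

Section CubeMoves.
Local Open Scope ring_scope.
Context {R : realType} {d : nat}.
Import boot.fintype boot.finset.
Implicit Types (u v A B : {set 'I_d}) (s t : {perm 'I_d}).
Local Open Scope classical_set_scope.

Local Notation P := (half_cube R d).

Lemma hvec_symmetry (phi : 'rV[R]_d -> 'rV[R]_d) (m : {set 'I_d} -> {set 'I_d}) :
  (forall x y, dot (phi x - phi y) (phi x - phi y) = dot (x - y) (x - y)) ->
  (forall A, ~~ odd #|A| -> ~~ odd #|m A|) ->
  {in [set A : {set 'I_d} | ~~ odd #|A|]%SET &, injective m} ->
  (forall A, ~~ odd #|A| -> phi (hvec A) = hvec (m A)) ->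
  symmetry P phi.
Proof.
move=> phi_dot m_even m_inj phi_m.
have phi_iso x y : edist (phi x) (phi y) = edist x y by rewrite /edist phi_dot.
split=> //; rewrite half_cubeE (image_hullv phi_iso (m := m)); last first.
  by move=> A; rewrite inE; exact: phi_m.
congr hullv; apply/eqP; rewrite eqEcard card_in_imset // leqnn andbT.
by apply/subsetP => _ /imsetP[A + ->]; rewrite !inE; exact: m_even.
Qed.

(** The coordinate is fetched at [s^-1] so that the support of a 0-1 vector moves to its image under
    [s]. *)
Definition cube_move s A (x : 'rV[R]_d) : 'rV[R]_d :=
  \row_i if i \in A then 1 - x 0 (s^-1%g i) else x 0 (s^-1%g i).

Definition set_move s A B : {set 'I_d} := s @: B :+: A.

Lemma cube_move_hvec s A B : cube_move s A (hvec B) = hvec (set_move s A B).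
Proof.
apply/rowP => i; rewrite !mxE in_symd.
have -> : (i \in s @: B) = (s^-1%g i \in B).
  by rewrite -{1}[i](permKV s) mem_imset //; exact: perm_inj.
case: (i \in A); case: (_ \in B) => //=; by rewrite ?subr0 ?subrr.
Qed.

Lemma set_move_inj s A : injective (set_move s A).
Proof.
move=> B C; rewrite /set_move => eqBC; apply: (imset_inj (@perm_inj _ s)).
by rewrite -[LHS](symdK _ A) eqBC symdK.
Qed.

Lemma cube_move_symmetry s A : ~~ odd #|A| -> symmetry P (cube_move s A).
Proof.
move=> Ae; apply: (hvec_symmetry (m := set_move s A)) => [x y|B Be|B C _ _|B _].
- rewrite /dot [RHS](reindex_inj (@perm_inj _ s^-1%g)); apply: eq_bigr => i _.
  by rewrite !mxE; case: (i \in A) => //; ring.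
- by rewrite odd_symd card_imset ?(negPf Be) //; exact: perm_inj.
- exact: set_move_inj.
- exact: cube_move_hvec.
Qed.

Lemma set_move1 s A u i :
  set_move s A (u :+: [set i]%SET) = set_move s A u :+: [set s i]%SET.
Proof.
rewrite /set_move imset_symd; last exact: perm_inj.
by rewrite imset_set1 -symdA [[set s i]%SET :+: _]symdC symdA.
Qed.

Lemma set_move_simplexv s A u (M : {set 'I_d}) :
  set_move s A @: simplexv u M = simplexv (set_move s A u) (s @: M).
Proof.
rewrite /simplexv -!imset_comp; apply: eq_imset => i /=; exact: set_move1.
Qed.

Lemma set_move_halfv s A u (Z : {set 'I_d}) : ~~ odd #|A| ->
  set_move s A @: halfv u Z = halfv (set_move s A u) (s @: Z).
Proof.
move=> Ae; have moveS B : (set_move s A B :+: set_move s A u \subset s @: Z) =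
    (B :+: u \subset Z).
  have -> : set_move s A B :+: set_move s A u = s @: (B :+: u).
    rewrite imset_symd; last exact: perm_inj.
    apply/setP => x; rewrite /set_move !in_symd.
    by case: (x \in A); case: (x \in _); case: (x \in _).
  apply/subsetP/subsetP => sub x; last by move=> /imsetP[y /sub yZ ->]; exact: imset_f.
  move=> xB; have := sub (s x); rewrite !mem_imset //; try exact: perm_inj.
  exact.
have even_move B : odd #|set_move s A B| = odd #|B|.
  by rewrite odd_symd card_imset ?(negPf Ae) ?addbF //; exact: perm_inj.
apply/setP => B; apply/imsetP/idP => [[C + ->]|].
  by rewrite !inE even_move moveS.
rewrite inE => /andP[Be BZ].
have BE : set_move s A (s^-1%g @: (B :+: A)) = B.
  rewrite /set_move -imset_comp [_ @: _](_ : _ = B :+: A) ?symdK //.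
  by rewrite -[RHS]imset_id; apply: eq_imset => i /=; rewrite permKV.
by exists (s^-1%g @: (B :+: A)); rewrite ?BE // inE -even_move -moveS BE Be.
Qed.

Lemma imset_below s t j : s @: below t j = below (s^-1 * t)%g j.
Proof.
apply/setP => x; rewrite -{1}[x](permKV s) mem_imset; last exact: perm_inj.
by rewrite !inE permM.
Qed.

Lemma cube_move_flag_of s A k u t : ~~ odd #|A| -> odd #|u| -> (2 < k <= d)%N ->
  act (cube_move s A) (flag_of k u t) =
  flag_of k (set_move s A u) (s^-1 * t)%g :> preflag R d.
Proof.
move=> Ae uo kd; apply/funext => i; rewrite /act /flag_of /cface.
have [move_iso _] := cube_move_symmetry s Ae.
rewrite (image_hullv move_iso (m := set_move s A)) => [|B _]; last exact: cube_move_hvec.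
congr hullv; rewrite /flag_code; case: ifP => _; rewrite /fverts /=.
  by rewrite set_move_simplexv imset_below.
by rewrite set_move_halfv // imset_below.
Qed.

(** [r] carries the chain of [s] to that of [t], and [A] corrects the base from [r @: u] to [v]; it
    is even because both are odd. *)
Lemma flag_of_transitive k u v s t : (2 < k <= d)%N -> odd #|u| -> odd #|v| ->
  exists2 phi : 'rV[R]_d -> 'rV[R]_d,
    symmetry P phi & act phi (flag_of k u s) = flag_of k v t.
Proof.
move=> kd uo vo; pose r := (s * t^-1)%g; pose A := r @: u :+: v.
have Ae : ~~ odd #|A|.
  by rewrite odd_symd card_imset ?uo ?vo //; exact: perm_inj.
exists (cube_move r A); first exact: cube_move_symmetry.
rewrite cube_move_flag_of //; congr flag_of; first by rewrite /set_move symdKl.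
by rewrite /r invMg invgK mulgKV.
Qed.

End CubeMoves.

(** * The extra symmetry in dimension four *)

Section HalfCube4.
Local Open Scope ring_scope.
Context {R : realType}.
Import boot.fintype boot.finset.
Local Open Scope classical_set_scope.

Local Notation P := (half_cube R 4).

(* The half-4-cube is a cross-polytope with the antipodal vertices 0 and
   (1, 1, 1, 1), which this reflection swaps, fixing all other vertices. *)
Definition swap_antipodes (x : 'rV[R]_4) : 'rV[R]_4 :=
  \row_i (x 0 i + (1 - (\sum_j x 0 j) / 2%:R)).

Definition swap_sets (A : {set 'I_4}) : {set 'I_4} :=
  if #|A| == 2%N then A else (~: A)%SET.

Lemma swap_antipodes_hvec (A : {set 'I_4}) : ~~ odd #|A| ->
  swap_antipodes (hvec A) = hvec (swap_sets A).
Proof.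
move=> Ae; apply/rowP => i; rewrite !mxE /swap_sets.
have -> : \sum_j (hvec A : 'rV[R]_4) 0 j = #|A|%:R.
  by rewrite -sum1_card natr_sum [RHS]big_mkcond; apply: eq_bigr => j _; rewrite mxE; case: ifP.
have A4 : (#|A| <= 4)%N by rewrite -[leqRHS](card_ord 4) max_card.
have cA_eq (B : {set 'I_4}) : #|B| = 4%N -> i \in B.
  move=> cB; have -> : B = [set: 'I_4]%SET; last by rewrite inE.
  by apply/eqP; rewrite eqEcard subsetT cardsT card_ord cB /=.
case: ifPn => [/eqP->|cA2]; first by rewrite divff ?subrr ?addr0 // pnatr_eq0.
rewrite inE; have [cA0|cA0] := eqVneq #|A| 0%N.
  move/eqP: (cA0); rewrite cards_eq0 cA0 => /eqP->.
  by rewrite inE /= mul0r subr0 add0r.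
have cA4 : #|A| = 4%N by case: #|A| Ae cA0 cA2 A4 => [|[|[|[|[|]]]]].
by rewrite (cA_eq A cA4) cA4 /=; field.
Qed.

Lemma swap_antipodes_symmetry : symmetry P swap_antipodes.
Proof.
have A4 (A : {set 'I_4}) : (#|~: A| + #|A| = 4)%N%SET.
  by rewrite addnC cardsC card_ord.
apply: (hvec_symmetry (m := swap_sets)) => [x y|A Ae|A B _ _|]; last 1 first.
- exact: swap_antipodes_hvec.
- by rewrite /dot !big_ord_recl !big_ord0 !mxE !big_ord_recl !big_ord0; field.
- rewrite /swap_sets; case: ifP => // _; move: (congr1 odd (A4 A)).
  by rewrite oddD (negPf Ae) addbF => ->.
- rewrite /swap_sets; case: eqP => cA; case: eqP => cB // eqAB.
  + case: cB; apply/eqP; rewrite -(eqn_add2l 2) -[X in (X + _)%N == _]cA eqAB.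
    by rewrite A4.
  + case: cA; apply/eqP; rewrite -(eqn_add2l 2) -[X in (X + _)%N == _]cB -eqAB.
    by rewrite A4.
  + by rewrite -[A]setCK eqAB setCK.
Qed.

(** The faces of ranks 1 to 3 have vertices {3, j} with j < 3, which are fixed. The simplex of rank
    4 also contains the empty set, which moves to the full set; the image consists of all even sets
    containing 3, the half-cube over {0, 1, 2}. *)
Lemma swap_antipodes_flag_of :
  act swap_antipodes (flag_of 4 [set ord_max]%SET 1%g) =
  flag_of 3 [set ord_max]%SET 1%g :> preflag R 4.
Proof.
have [swap_iso _] := swap_antipodes_symmetry; pose u : {set 'I_4} := [set ord_max]%SET.
have uo : odd #|u| by rewrite cards1.
apply/funext => i; rewrite /act /flag_of /cface.
rewrite (image_hullv swap_iso (m := swap_sets)) => [|B Bf]; last first.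
  apply: swap_antipodes_hvec; apply: even_fverts Bf.
  by apply: valid_flag_code => //; rewrite ltnW // ltnS.
congr hullv; rewrite /flag_code (ltn_ord i).
have swap_simplex (j : 'I_4) : swap_sets (u :+: [set j]%SET) =
    if j == ord_max then [set: 'I_4]%SET else u :+: [set j]%SET.
  have [->|ju] := eqVneq j ord_max.
    by rewrite /swap_sets symdv cards0 /= setC0.
  rewrite /swap_sets; suff -> : u :+: [set j]%SET = [set ord_max; j]%SET.
    by rewrite cards2 [ord_max == j]eq_sym ju.
  apply/setP => x; rewrite in_symd !inE.
  by have [->|] := eqVneq x ord_max; rewrite ?addbF //= [ord_max == j]eq_sym (negPf ju).
case: (ltnP i 3) => i3; rewrite /fverts /=.
  rewrite -[RHS]imset_id /simplexv -imset_comp [RHS]imset_id.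
  apply: eq_in_imset => j; rewrite inE perm1 ltnS => ji /=.
  rewrite swap_simplex; case: eqP => // jmax; move: ji.
  by rewrite jmax leqNgt i3.
have -> : nat_of_ord i = 3 by apply/anti_leq; rewrite i3 -ltnS ltn_ord.
have max_half (A : {set 'I_4}) : (A \in halfv u (below 1%g 3)) =
    ~~ odd #|A| && (ord_max \in A).
  rewrite inE; congr (_ && _); apply/subsetP/idP => [sub|maxA x].
    apply: contraT => maxA; have := sub ord_max.
    by rewrite in_symd !inE (negPf maxA) eqxx perm1 => /(_ isT).
  rewrite in_symd !inE perm1; have [->|xmax _] := eqVneq x ord_max.
    by rewrite maxA.
  have : (x <= 3)%N by rewrite -ltnS ltn_ord.
  by rewrite leq_eqVlt => /orP[/eqP xE|//]; case/eqP: xmax; exact/val_inj.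
apply/setP => A; rewrite max_half.
apply/imsetP/andP => [[B /imsetP[j _ ->] ->]|[Ae maxA]].
  rewrite swap_simplex; case: eqVneq => [_|ju].
    by rewrite cardsT card_ord inE.
  by rewrite odd_symd !cards1 in_symd !inE eqxx [ord_max == j]eq_sym (negPf ju).
have [j jA] : exists j, A = swap_sets (u :+: [set j]%SET).
  have := cardsD1 ord_max A; rewrite maxA => cA.
  have A4 : (#|A| <= 4)%N by rewrite -[leqRHS](card_ord 4) max_card.
  have [cA4|cA4] := eqVneq #|A| 4.
    exists ord_max; rewrite swap_simplex eqxx.
    by apply/eqP; rewrite eqEcard subsetT cardsT card_ord cA4 /=.
  have /eqP/cards1P[j jE] : #|A :\ ord_max| = 1%N.
    by move: Ae A4 cA4; rewrite cA; case: #|_| => [|[|[|[|]]]].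
  have : j \in A :\ ord_max by rewrite jE set11.
  rewrite !inE => /andP[ju _].
  exists j; rewrite swap_simplex (negPf ju) -(setD1K maxA) jE.
  apply/setP => x; rewrite in_symd !inE.
  by have [->|] := eqVneq x ord_max; rewrite ?addbF //= [ord_max == j]eq_sym (negPf ju).
by exists (u :+: [set j]%SET) => //; rewrite mem_simplexv1 inE perm1 (ltn_ord j).
Qed.

End HalfCube4.

(** * Cycles of a function as orbits *)

Lemma fcycle_closed (T : eqType) (f : T -> T) p x :
  fcycle f p -> x \in p -> f x \in p.
Proof. by move=> fp xp; rewrite (eqP (next_cycle fp xp)) mem_next. Qed.

Lemma fcycle_orbit (T : eqType) (f : T -> T) p x y :
  fcycle f p -> x \in p -> y \in p -> exists n, y = iter n f x.
Proof.
move=> fp xp; have [i q rotE] := rot_to xp; rewrite -(mem_rot i) rotE.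
move: fp; rewrite -(rot_cycle i) rotE /= rcons_path => /andP[/fpathP[n ->] _].
by rewrite -trajectS => /trajectP[k _ ->]; exists k.
Qed.

(** Both lists run through the orbit of [x], but may start at different elements. *)
Lemma fcycle_perm_eq (T : eqType) (f : T -> T) p q x :
  uniq p -> uniq q -> fcycle f p -> fcycle f q -> x \in p -> x \in q ->
  perm_eq p q.
Proof.
have sub p' q' : fcycle f p' -> fcycle f q' -> x \in p' -> x \in q' ->
    {subset p' <= q'}.
  move=> fp' fq' xp' xq' y /(fcycle_orbit fp' xp')[n ->].
  by elim: n => //= n; exact: fcycle_closed.
move=> up uq fp fq xp xq; apply: uniq_perm => // y; apply/idP/idP; exact: sub.
Qed.

(** * Invariance of the signature and uniformity *)

Section Zigzags.
Local Open Scope ring_scope.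
Context {R : realType} {d : nat} (hd : (2 < d)%N).
Implicit Types (phi psi : 'rV[R]_d -> 'rV[R]_d) (Z : seq (preflag R d)).
Implicit Types (u v : {set 'I_d}) (s t : {perm 'I_d}).

Local Notation P := (half_cube R d).

Lemma signature_perm_eq Z Z' : perm_eq Z Z' -> signature P Z = signature P Z'.
Proof.
move=> ZZ'; rewrite /signature; congr (_%:R / _, _%:R / _).
  rewrite (seq.permP ZZ'); apply: eq_count => f; exact: perm_mem.
rewrite (seq.permP ZZ'); apply: eq_count => f.
by rewrite /zigzag_reverse !mem_rev; apply: perm_mem; exact: perm_map.
Qed.

Lemma act_inj phi : symmetry P phi -> injective (act phi).
Proof.
by move=> /symmetry_inverse[psi [_ phiK _]]; exact: can_inj (act_can phiK).
Qed.

Lemma zigzag_act phi Z : symmetry P phi -> zigzag P Z ->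
  zigzag P (map (act phi) Z).
Proof.
move=> sym [Z0 Zfl uZ cZ]; split.
- by case: Z Z0 {Zfl uZ cZ}.
- by move=> _ /mapP[f fZ ->]; apply: act_is_flag sym (Zfl _ fZ).
- by rewrite (map_inj_uniq (act_inj sym)).
- apply: (homo_cycle_in (P := mem Z)) cZ; last exact/allP.
  move=> f g fZ _ /eqP <-; apply/eqP.
  by have [] := zstep_act hd sym (Zfl _ fZ).
Qed.

Lemma signature_act phi Z : symmetry P phi -> zigzag P Z ->
  signature P (map (act phi) Z) = signature P Z.
Proof.
move=> sym [_ Zfl _ _]; rewrite /signature !count_map.
have sigma1 f : f \in Z -> sigma P 1 (act phi f) = act phi (sigma P 1 f).
  by move=> /Zfl fl; rewrite (sigma_act hd sym fl) // (ltn_trans _ hd).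
congr (_%:R / _, _%:R / _); apply: eq_in_count => f fZ /=; rewrite sigma1 //.
  exact: mem_map (act_inj sym) _ _.
rewrite /zigzag_reverse -map_comp.
have -> : map (flag_reverse P \o act phi) Z = map (act phi) (map (flag_reverse P) Z).
  by rewrite -map_comp; apply: eq_map => g /=; rewrite flag_reverse_act.
by rewrite -map_rev (mem_map (act_inj sym)).
Qed.

Lemma zigzag_top Z : zigzag P Z ->
  exists u s, odd #|u| /\ (flag_of d u s : preflag R d) \in Z.
Proof.
case=> Z0 Zfl _ cZ; have [f fZ] : exists f, f \in Z.
  by case: Z Z0 {Zfl cZ} => // f Z _; exists f; rewrite mem_head.
have [k [u [s [kd uo fE]]]] := flag_ofP hd (Zfl _ fZ); subst f.
have [n [u' [s' [uo' nE]]]] := iter_zstep_top (R := R) hd s kd uo.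
exists u', s'; split=> //; rewrite -nE.
by elim: n {nE} => //= n; exact: fcycle_closed.
Qed.

Lemma half_cube_z_uniform : z_uniform P.
Proof.
move=> Z Z' zZ zZ'.
have [u [s [uo fZ]]] := zigzag_top zZ; have [v [t [vo gZ']]] := zigzag_top zZ'.
have dd : (2 < d <= d)%N by rewrite hd leqnn.
have [phi sym phi_fg] := flag_of_transitive (R := R) s t dd uo vo.
rewrite -(signature_act sym zZ) -(size_map (act phi) Z).
have [_ _ u1 c1] := zigzag_act sym zZ; have [_ _ u2 c2] := zZ'.
(* The moved [Z] and [Z'] are orbits of [zstep] through a common flag. *)
have ZZ' : perm_eq (map (act phi) Z) Z'.
  by apply: fcycle_perm_eq u1 u2 c1 c2 _ gZ'; rewrite -phi_fg map_f.
by rewrite (perm_size ZZ') (signature_perm_eq ZZ').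
Qed.

End Zigzags.

(** * Counting flags and their orbits *)

Section FlagOrbits.
Local Open Scope ring_scope.
Context {R : realType} {d : nat} (hd : (2 < d)%N).
Implicit Types (u v : {set 'I_d}) (s t : {perm 'I_d}) (f : preflag R d).
Local Open Scope classical_set_scope.

Local Notation P := (half_cube R d).

Let x0 : 'I_d := Ordinal (ltn_trans (isT : 0 < 2)%N hd).
Let u0 : {set 'I_d} := [set x0]%SET.

Lemma odd_u0 : odd #|u0|. Proof. by rewrite cards1. Qed.

Lemma card_flags : (flags P #= `I_(d`! * 2 ^ (d - 1) * (d - 2)))%card.
Proof.
(* The three factors count [k], shifted by 3 to start at 0, the odd base, and the permutation. *)
pose X := [set p : 'I_(d - 2) * {set 'I_d} * {perm 'I_d} | odd #|p.1.2|]%SET.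
pose F (p : 'I_(d - 2) * {set 'I_d} * {perm 'I_d}) : preflag R d :=
  flag_of (p.1.1 + 3) p.1.2 p.2.
have kd (k : 'I_(d - 2)) : (2 < k + 3 <= d)%N.
  by have := ltn_ord k; lia.
have -> : flags P = F @` [set` X].
  apply/seteqP; split=> [f /(flag_ofP hd)[k [u [s [kd' uo ->]]]]|].
    have k3d : (k - 3 < d - 2)%N by lia.
    exists (Ordinal k3d, u, s); first by rewrite /= inE.
    by rewrite /F /= subnK //; case/andP: kd'.
  move=> _ [p /= + <-]; rewrite inE => po; exact: flag_of_is_flag.
have <- : #|X| = (d`! * 2 ^ (d - 1) * (d - 2))%N.
  have -> : X = finset.setX (finset.setX [set: 'I_(d - 2)]%SET
      [set A : {set 'I_d} | odd #|A|]%SET) [set: {perm 'I_d}]%SET.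
    by apply/finset.setP => -[[k u] s]; rewrite !inE andbT.
  rewrite !cardsX !cardsT (card_odd_sets x0) !card_ord card_Sn subn1.
  by rewrite mulnC [RHS]mulnC; lia.
have d2 : (0 < d - 2)%N by rewrite subn_gt0.
apply: card_image_finset (Ordinal d2, u0, 1%g) _ => -[[k u] s] [[l v] t].
rewrite !inE /= => uo vo /(flag_of_inj (kd k) (kd l) uo vo)[/=].
by move=> /addIn/val_inj-> -> ->.
Qed.

Lemma flag_orbit_act (phi : 'rV[R]_d -> 'rV[R]_d) f : symmetry P phi ->
  flag_orbit P (act phi f) = flag_orbit P f.
Proof.
move=> sym; have [psi [psi_sym phiK _]] := symmetry_inverse sym.
apply/seteqP; split=> g [theta theta_sym ->].
  exists (theta \o phi); first exact: symmetry_comp.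
  by rewrite -/(act theta (act phi f)) act_comp.
exists (theta \o psi); first exact: symmetry_comp.
by rewrite -/(act (theta \o psi) (act phi f)) -act_comp (act_can phiK).
Qed.

Definition type_orbit k : set (preflag R d) := flag_orbit P (flag_of k u0 1%g).

Lemma flag_orbit_of k u s : (2 < k <= d)%N -> odd #|u| ->
  flag_orbit P (flag_of k u s) = type_orbit k.
Proof.
move=> kd uo; have [phi sym <-] := flag_of_transitive (R := R) 1%g s kd odd_u0 uo.
exact: flag_orbit_act.
Qed.

Lemma flag_orbitsE : flag_orbits P = type_orbit @` [set k | 2 < k <= d]%N.
Proof.
apply/seteqP; split=> [_ [f /(flag_ofP hd)[k [u [s [kd uo ->]]]] <-]|_ [k kd <-]].
  by exists k; rewrite ?flag_orbit_of.
exists (flag_of k u0 1%g) => //; exact: flag_of_is_flag odd_u0.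
Qed.

Lemma card_flag_orbits : (4 < d)%N -> (flag_orbits P #= `I_(d - 2))%card.
Proof.
move=> d5; have -> : flag_orbits P = (fun k => type_orbit (k + 3)) @` `I_(d - 2).
  rewrite flag_orbitsE; apply/seteqP; split=> [_ [k /= kd <-]|_ [k /= kd <-]].
    by exists (k - 3)%N; [rewrite /=; lia | rewrite subnK //; case/andP: kd].
  by exists (k + 3)%N => //=; lia.
apply: inj_card_eq => k l; rewrite !inE /= => kd ld eq_kl.
have k3d : (2 < k + 3 <= d)%N by lia.
have l3d : (2 < l + 3 <= d)%N by lia.
have : type_orbit (k + 3) (flag_of (k + 3) u0 1%g).
  by exists id; [exact: symmetry_id | rewrite -[LHS]act_id].
rewrite eq_kl => -[phi sym /esym] /(act_flag_of_type hd d5 sym l3d k3d odd_u0 odd_u0).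
by move=> /addIn.
Qed.

End FlagOrbits.

(** For [d] = 3 only [k] = 3 is possible; for [d] = 4 [swap_antipodes] merges the orbits for 3 and
    4. *)
Lemma card_flag_orbits_small (R : realType) (d : nat) (hd : (2 < d)%N) :
  (d <= 4)%N -> (flag_orbits (half_cube R d) #= `I_1)%card.
Proof.
move=> d4; suff -> : flag_orbits (half_cube R d) =
  [set type_orbit (R := R) hd 3]%classic by exact: card_set1.
rewrite (flag_orbitsE hd); apply/seteqP.
split=> [_ [k /= kd <-]|_ ->]; last by exists 3 => //=; rewrite hd.
have [dE|dn4] := eqVneq d 4%N; last by congr type_orbit; lia.
subst d; have [->//|kn3] := eqVneq k 3%N; have -> : k = 4%N by lia.
have uo : odd #|[set ord_max : 'I_4]%SET| by rewrite cards1.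
rewrite -(flag_orbit_of hd 1%g (isT : 2 < 4 <= 4)%N uo).
rewrite -(flag_orbit_of hd 1%g (isT : 2 < 3 <= 4)%N uo) -swap_antipodes_flag_of.
by rewrite flag_orbit_act //; exact: swap_antipodes_symmetry.
Qed.

Theorem proposition4p2 (R : realType) (d : nat) (hd : (3 <= d)%N) :
  [/\ (flags (half_cube R d) #= `I_(d`! * 2 ^ (d - 1) * (d - 2)))%card,
      ((d <= 4)%N -> (flag_orbits (half_cube R d) #= `I_1)%card),
      ((5 <= d)%N -> (flag_orbits (half_cube R d) #= `I_(d - 2))%card)
    & z_uniform (half_cube R d)].
Proof.
split; [exact: card_flags | exact: card_flag_orbits_small
  | exact: card_flag_orbits | exact: half_cube_z_uniform].
Qed.
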